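(* Let $f(u)=u[\log(1+u)]^a$ with $1<a<2$. Let $V,\phi\in C^1([-1,1])$ with $V,\phi\ge 0$, $V(0)>0$, $\phi(0)>0$ and $\phi(1)=0$. Assume that $V$ and $\phi$ are even and satisfy $$V'\le 0,\ \phi'\le 0\quad\text{on }[0,1/3],$$ $$0\le V(x)\le V(1/3),\quad 0\le\phi(x)\le\phi(1/3)\quad\text{on }[1/3,1].$$ Let $u_0=\lambda\phi$ with $\lambda>0$, let $u\ge0$ be the unique, maximal classical solution of $$u_t=u_{xx}+V(x)f(u),\quad t>0,\ x\in(-1,1),$$ $$u(t,-1)=u(t,1)=0,\quad t>0,\qquad u(0,x)=u_0(x),\quad x\in(-1,1),$$ and let $T=T(u_0)\in(0,\infty]$ be its existence time. (i) Then $T<\infty$ for all $\lambda>0$ sufficiently large and, whenever $T<\infty$, blowup is global, namely $$\lim_{t\to T}u(t,x)=\infty\quad\text{for every }x\in(-1,1).$$ (ii) Assume moreover that $\phi\in C^2([-1,1])$ and that, for some $r\in(0,1)$, $\phi>0$ and $V>0$ on $[0,r]$ and $\phi_{xx}\ge 0$ on $[r,1]$. Then, for all $\lambda>0$ sufficiently large, $u_t\ge0$.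
   Context: The maximal classical solution is the classical solution (continuous on $[0,T)\times[-1,1]$, $C^1$ in $t$ and $C^2$ in $x$ for $t>0$) defined on the largest possible time interval $[0,T)$; if $T<\infty$ then $\max_{x\in[-1,1]}u(t,x)$ tends to $\infty$ as $t\to T$. *)

(* Defs.v *)
From mathcomp Require Import all_boot all_order all_algebra.
From mathcomp Require Import all_classical all_reals all_analysis.
Import Order.TTheory GRing.Theory Num.Theory.
Import numFieldNormedType.Exports.

Set Implicit Arguments.
Unset Strict Implicit.
Unset Printing Implicit Defensive.

Local Open Scope classical_set_scope.
Local Open Scope ring_scope.

Section RelativeDerivative.
Context {R : realType}.
Implicit Types (A : set R) (f : R -> R) (x : R).

(* Derivatives of functions on a set A, here always [-1, 1]: the difference
   quotient only sees points of A, so it is one-sided at the end points and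
   agrees with the usual derivative at interior points. *)
Definition derivable_on A f x : Prop :=
  cvg ((f y - f x) / (y - x) @[y --> within A x^']).

Definition derive_on A f x : R :=
  lim ((f y - f x) / (y - x) @[y --> within A x^']).

Definition C1_on A f : Prop :=
  (forall x, A x -> derivable_on A f x) /\
  {within A, continuous (derive_on A f)}.

Definition C2_on A f : Prop := C1_on A f /\ C1_on A (derive_on A f).

End RelativeDerivative.

Section Problem.
Context {R : realType}.

Definition cI : set R := `[(-1 : R), 1].

Definition source (a u : R) : R := u * ln (1 + u) `^ a.

Definition u_t (u : R -> R -> R) (t x : R) : R := derive1 (fun s => u s x) t.
Definition u_x (u : R -> R -> R) (t x : R) : R := derive_on cI (u t) x.
Definition u_xx (u : R -> R -> R) (t x : R) : R :=
  derive_on cI (derive_on cI (u t)) x.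

(* [0, T) x [-1, 1] and (0, T) x [-1, 1], with T possibly infinite. *)
Definition cylinder (T : \bar R) : set (R * R) :=
  [set z | 0 <= z.1 /\ (z.1%:E < T)%E /\ cI z.2].
Definition open_cylinder (T : \bar R) : set (R * R) :=
  [set z | 0 < z.1 /\ (z.1%:E < T)%E /\ cI z.2].

Record classical_solution (a : R) (V u0 : R -> R) (T : \bar R)
    (u : R -> R -> R) : Prop := ClassicalSolution {
  sol_time_gt0 : (0 < T)%E;
  sol_continuous : {within cylinder T, continuous (fun z => u z.1 z.2)};
  sol_derivable_t : forall t x, open_cylinder T (t, x) ->
    derivable (fun s => u s x) t 1;
  sol_derivable_x : forall t x, open_cylinder T (t, x) ->
    derivable_on cI (u t) x;
  sol_derivable_xx : forall t x, open_cylinder T (t, x) ->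
    derivable_on cI (derive_on cI (u t)) x;
  sol_continuous_t :
    {within open_cylinder T, continuous (fun z => u_t u z.1 z.2)};
  sol_continuous_x :
    {within open_cylinder T, continuous (fun z => u_x u z.1 z.2)};
  sol_continuous_xx :
    {within open_cylinder T, continuous (fun z => u_xx u z.1 z.2)};
  sol_ge0 : forall t x, cylinder T (t, x) -> 0 <= u t x;
  sol_pde : forall t x : R, 0 < t -> (t%:E < T)%E -> -1 < x < 1 ->
    u_t u t x = u_xx u t x + V x * source a (u t x);
  sol_boundary : forall t : R, 0 < t -> (t%:E < T)%E ->
    u t (-1) = 0 /\ u t 1 = 0;
  sol_initial : forall x : R, -1 < x < 1 -> u 0 x = u0 x }.

(* The blowup alternative is part of the notion. The supremum is a maximum,
   u t being continuous on [-1, 1]. *)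
Record maximal_solution (a : R) (V u0 : R -> R) (T : \bar R)
    (u : R -> R -> R) : Prop := MaximalSolution {
  max_classical : classical_solution a V u0 T u;
  max_largest : forall (T' : \bar R) (v : R -> R -> R),
    classical_solution a V u0 T' v -> (T' <= T)%E;
  max_blowup : (T < +oo)%E ->
    sup (u t @` cI) @[t --> (fine T)^'-] --> +oo }.

End Problem.

(* Main.v *)
(* Everything rests on the minimum principle on compact sets. Reflections about
   [0] and [1/3], followed by a two-point comparison on [|x| <= y <= 1/3], show
   that [u(t, .)] is largest at [0]. There [m(t) = u(t, 0)] satisfies
   [m' <= V(0) m (log (1 + m)) ^ a], so blowup at [T] forces
   [log (1 + m) >= c (T - t) ^ (- 1 / (a - 1))]; since [a < 2] this exceeds
   [1 / (T - t)] near [T]. Consequently [u] dominates, up to a constant, the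
   subsolution [exp ((1 - x)^2 / (T - t))] of the heat equation on [[0, 1]],
   which blows up at every [x < 1]. In the same way
   [exp (A(t) (1 - x^2 / delta^2)) - 1] is a subsolution near [0] when
   [A' = eps A ^ a], and it blows up in finite time because [a > 1]. For (ii),
   [lambda phi] is a subsolution for large [lambda], hence
   [u(t + h, .) >= u(t, .)]. *)
Require Import Defs.
From mathcomp Require Import all_boot all_order all_algebra.
From mathcomp Require Import all_classical all_reals all_analysis.
From mathcomp Require Import ring lra.
Import Order.TTheory GRing.Theory Num.Theory.
Import numFieldNormedType.Exports.

Set Implicit Arguments.
Unset Strict Implicit.
Unset Printing Implicit Defensive.

Local Open Scope classical_set_scope.
Local Open Scope ring_scope.

(** A classical solution has one time derivative and two space derivatives, so the equation cannot
    be differentiated to obtain one for [u_x] or [u_t]. This is why monotonicity in space compares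
    [u] at two points, and monotonicity in time compares [u] with its translates. The abscissa
    [1 / 3] is the smallest one whose reflection works: it sends [[1/3, 1]] onto [[-1/3, 1/3]],
    where an even profile nonincreasing on [[0, 1/3]] is at least its value at [1 / 3]. Both
    exponential subsolutions exploit one formula: for [v = exp (A(t) q(x))], the quantity
    [v_t - v_xx] is [v] times [A' q - A q'' - (A q')^2], and the quadratic term competes with an
    [A'] of order at most [A^2]. For [q = (1 - x)^2] it wins everywhere, since [q'^2 = 4 q]; for
    [q = 1 - x^2 / delta^2] it wins away from [0], and near [0] the source takes over. *)

Lemma continuous_within_comp (T U W : topologicalType) (A : set U) (B : set T)
    (f : U -> W) (g : T -> U) :
  {within A, continuous f} -> {within B, continuous g} ->
  (forall z, B z -> A (g z)) ->
  {within B, continuous (fun z => f (g z))}.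
Proof.
move=> /subspace_continuousP cf /subspace_continuousP cg gBA.
apply/subspace_continuousP => z Bz.
apply: (cvg_comp g f _ (cf _ (gBA _ Bz))) => N.
rewrite /within /= => /(cg _ Bz); rewrite /nbhs /= /within /=.
by apply: filterS => y + By => /(_ By); apply; exact: gBA.
Qed.

Lemma continuous_pair (T U W : topologicalType) (f : T -> U) (g : T -> W) :
  continuous f -> continuous g -> continuous (fun z => (f z, g z)).
Proof. by move=> cf cg z; apply: cvg_pair; [exact: cf|exact: cg]. Qed.

(** * Derivative tests at one-sided and interior minima *)

Section OneVariable.
Context {R : realType}.
Implicit Types (f g : R -> R) (x y d e : R).

Lemma is_derive1_quotient f x d :
  (f y - f x) / (y - x) @[y --> x^'] --> d -> is_derive x 1 f d.
Proof.
move=> fd.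
have E : h^-1 *: (f (h *: 1 + x) - f x) @[h --> 0^'] --> d.
  move/cvgrPdist_le : fd => fd; apply/cvgrPdist_le => e e0.
  have := fd _ e0; rewrite !near_withinE => /nbhs_ballP[r /= r0 rb].
  apply/nbhs_ballP; exists r => //= h hr h0.
  have := rb (h + x); rewrite /ball /= (_ : x - (h + x) = 0 - h); last by ring.
  by rewrite -subr_eq0 addrK /GRing.scale /= mulr1 mulrC; apply.
split; first by apply/cvg_ex; exists d.
exact: cvg_lim E.
Qed.

Lemma is_derive_ext f g x d d' :
  is_derive x 1 f d -> f =1 g -> d = d' -> is_derive x 1 g d'.
Proof. by move=> fd /funext <- <-. Qed.

Lemma derive_on_interior (A : set R) f x : nbhs x A ->
  derivable_on A f x -> is_derive x 1 f (derive_on A f x).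
Proof.
move=> xA fx; apply: is_derive1_quotient.
apply: (cvg_trans _ fx); apply: cvg_app => P Px.
rewrite /= in Px; have {}Px : nbhs x (fun y => y != x -> A y -> P y) := Px.
suff : nbhs x (fun y => y != x -> P y) by [].
by apply: filterS2 xA Px => y Ay Py yx; exact: Py.
Qed.

Lemma is_derive_gt0 f x d : is_derive x 1 f d -> 0 < d ->
  exists2 e, 0 < e & forall y,
    (x - e < y < x -> f y < f x) /\ (x < y < x + e -> f x < f y).
Proof.
move=> [fx <-] d0.
have /cvgrPdist_lt/(_ _ d0) : h^-1 *: (f (h *: 1 + x) - f x) @[h --> 0^'] --> 'D_1 f x.
  exact: fx.
rewrite near_withinE => /nbhs_ballP[r /= r0 rb].
exists r => // y.
have key : y != x -> `|y - x| < r -> 0 < (y - x)^-1 * (f y - f x).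
  move=> yx yr; have := rb (y - x); rewrite /ball /= sub0r normrN => /(_ yr).
  rewrite subr_eq0 => /(_ yx); rewrite /GRing.scale /= mulr1 subrK.
  by rewrite ltr_norml => /andP[_]; rewrite ltrBlDr ltrDl.
split=> /andP[y1 y2].
- have yx : y - x < 0 by rewrite subr_lt0.
  have := key; rewrite lt_eqF// ltr0_norm// => /(_ isT) /(_ ltac:(lra)).
  by rewrite nmulr_rgt0 ?invr_lt0// subr_lt0.
- have yx : 0 < y - x by rewrite subr_gt0.
  have := key; rewrite gt_eqF// gtr0_norm// => /(_ isT) /(_ ltac:(lra)).
  by rewrite pmulr_rgt0 ?invr_gt0// subr_gt0.
Qed.

(** Only points on the left are compared: a minimum over a time interval may sit at the final time,
    and a minimum in space at the right end. *)
Lemma left_min_derive_le0 f x d e : is_derive x 1 f d -> 0 < e ->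
  (forall y, x - e < y < x -> f x <= f y) -> d <= 0.
Proof.
move=> fd e0 fmin; rewrite leNgt; apply/negP => d0.
have [r r0 rP] := is_derive_gt0 fd d0.
pose y := x - Num.min e r / 2.
have m0 : 0 < Num.min e r by rewrite lt_min e0.
have me : Num.min e r <= e by rewrite ge_min lexx.
have mr : Num.min e r <= r by rewrite ge_min lexx orbT.
have [+ _] := rP y; have := fmin y; rewrite /y => A B.
have := A ltac:(lra); have := B ltac:(lra); lra.
Qed.

Lemma right_min_derive_ge0 f x d e : is_derive x 1 f d -> 0 < e ->
  (forall y, x < y < x + e -> f x <= f y) -> 0 <= d.
Proof.
move=> fd e0 fmin; rewrite leNgt; apply/negP => d0.
have [|r r0 rP] := @is_derive_gt0 (- f) x (- d) _; first by rewrite oppr_gt0.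
pose y := x + Num.min e r / 2.
have m0 : 0 < Num.min e r by rewrite lt_min e0.
have me : Num.min e r <= e by rewrite ge_min lexx.
have mr : Num.min e r <= r by rewrite ge_min lexx orbT.
have [_ +] := rP y; have := fmin y; rewrite /y /GRing.opp /= => A B.
have := A ltac:(lra); have := B ltac:(lra); lra.
Qed.

(** A first derivative that vanishes at [x] with [d < 0] is negative just to the right of [x], where
    the mean value theorem produces a smaller value of [f]. The second derivative is needed at [x]
    alone. *)
Lemma local_min_second_derive f (df : R -> R) x d e : 0 < e ->
  (\forall y \near x, is_derive (y : R) (1 : R) f (df y)) -> is_derive x 1 df d ->
  (forall y, x - e < y < x + e -> f x <= f y) -> 0 <= d.
Proof.
move=> e0 fdf dfd fmin; rewrite leNgt; apply/negP => d0.
have dfx : df x = 0.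
  have fx := nbhs_singleton fdf; apply/eqP; rewrite eq_le; apply/andP; split.
    by apply: (left_min_derive_le0 fx e0) => // y ?; apply: fmin; lra.
  by apply: (right_min_derive_ge0 fx e0) => // y ?; apply: fmin; lra.
have [|r r0 rP] := @is_derive_gt0 (- df) x (- d) _; first by rewrite oppr_gt0.
move/nbhs_ballP : fdf => [s /= s0 sb].
pose m := Num.min e (Num.min r s).
have m0 : 0 < m by rewrite !lt_min e0 r0.
have me : m <= e by rewrite ge_min lexx.
have mr : m <= r by rewrite !ge_min lexx orbT.
have ms : m <= s by rewrite !ge_min lexx !orbT.
have fd y : x - m < y < x + m -> is_derive y 1 f (df y).
  move=> ym; apply: sb; rewrite /ball /= ltr_norml; lra.
have fc : {within `[x, x + m / 2], continuous f}.
  apply: derivable_within_continuous => y; rewrite in_itv /= => ?.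
  by have [] : is_derive y 1 f (df y) by apply: fd; lra.
have [||c + {}fc] := @MVT R f df _ _ _ _ fc.
- lra.
- by move=> y; rewrite in_itv /= => ?; apply: fd; lra.
rewrite in_itv /= => cx.
have := fmin (x + m / 2) ltac:(lra).
have [_ /(_ ltac:(lra))] := rP c; rewrite /GRing.opp /= dfx oppr0 oppr_gt0 => dc.
have : df c * (x + m / 2 - x) < 0 by rewrite nmulr_rlt0//; lra.
rewrite -fc; lra.
Qed.

End OneVariable.

(** * The nonlinearity *)

Section Source.
Context {R : realType}.


Lemma source_ge0 (a x : R) : 0 <= x -> 0 <= source a x.
Proof. by move=> x0; rewrite mulr_ge0// powR_ge0. Qed.

Lemma is_derive_source (a x : R) : 0 < x ->
  is_derive x 1 (source a)
    (ln (1 + x) `^ a + x * (a * ln (1 + x) `^ (a - 1) * (1 + x)^-1)).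
Proof.
move=> x0.
have l0 : 0 < ln (1 + x) by rewrite ln_gt0//; lra.
have D1 : is_derive x 1 ((@ln R) \o (fun u => 1 + u)) ((1 + x)^-1 * (0 + 1)).
  by apply: is_derive1_comp; apply: is_derive1_ln; lra.
have D2 : is_derive x 1 ((@powR R ^~ a) \o ((@ln R) \o (fun u => 1 + u)))
    (a * ln (1 + x) `^ (a - 1) * ((1 + x)^-1 * (0 + 1))).
  by apply: is_derive1_comp; exact: is_derive1_powR.
have := is_deriveM (is_derive_id x 1) D2.
rewrite /GRing.scale /= add0r !mulr1 [X in is_derive _ _ _ X]addrC; exact.
Qed.

(** The constant bounds the derivative of [source a] on []0, M]], using [x / (1 + x) <= 1]. *)
Lemma source_lipschitz (a M : R) : 1 < a -> 0 <= M -> exists2 L, 0 <= L &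
  forall x y, 0 <= x -> x <= y -> y <= M ->
    source a y - source a x <= L * (y - x).
Proof.
move=> a1 M0; pose l := ln (1 + M).
have l0 : 0 <= l by rewrite ln_ge0//; lra.
have mono b u : 0 <= b -> 0 <= u <= M -> ln (1 + u) `^ b <= l `^ b.
  by move=> b0 uM; apply: ge0_ler_powR; rewrite ?nnegrE ?ln_ge0 ?ler_ln ?posrE; lra.
exists (l `^ a + a * l `^ (a - 1)).
  by rewrite addr_ge0 ?mulr_ge0 ?powR_ge0//; lra.
move=> x y x0 xy yM.
have al0 : 0 <= a * l `^ (a - 1) by rewrite mulr_ge0 ?powR_ge0//; lra.
(* The derivative formula requires a positive argument, so the end point [0], where [source a]
   vanishes, is treated by hand. *)
have [xE|x1] := eqVneq x 0.
  rewrite xE /source mul0r !subr0 mulrC ler_wpM2r//; first lra.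
  by rewrite (le_trans (mono a y _ _)) ?lerDl//; lra.
have {x0 x1} x0 : 0 < x by rewrite lt_neqAle eq_sym x1.
have fc : {within `[x, y], continuous (source a)}.
  apply: derivable_within_continuous => z; rewrite in_itv /= => xz.
  by have [] := @is_derive_source a z ltac:(lra).
pose df (z : R) := ln (1 + z) `^ a + z * (a * ln (1 + z) `^ (a - 1) * (1 + z)^-1).
have fd z : z \in `]x, y[ -> is_derive z 1 (source a) (df z).
  by rewrite in_itv /= => xz; apply: is_derive_source; lra.
have [c + ->] := MVT_segment xy fd fc.
rewrite in_itv /= => xc; rewrite ler_wpM2r//; first lra.
apply: lerD; first by apply: mono; lra.
have c1 : (1 + c)^-1 * c <= 1.
  by rewrite mulrC ler_pdivrMr; lra.
rewrite [leLHS](_ : _ = a * ln (1 + c) `^ (a - 1) * ((1 + c)^-1 * c)); last by ring.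
rewrite -[leRHS]mulr1; apply: ler_pM => //.
- by rewrite mulr_ge0 ?powR_ge0//; lra.
- by rewrite mulr_ge0 ?invr_ge0//; lra.
- by rewrite ler_wpM2l ?mono//; lra.
Qed.


End Source.

(** * A pointwise heat operator *)

(** A relation rather than a function: it packs the value [W_t - W_xx] with the differentiability
    that gives it sense, at a single point. *)
Definition heat_op {R : realType} (W : R -> R -> R) (t x h : R) : Prop :=
  exists (Wt Wxx : R) (dW : R -> R),
    [/\ is_derive t (1 : R) (W ^~ x) Wt,
        \forall y \near x, is_derive (y : R) (1 : R) (W t) (dW y),
        is_derive x (1 : R) dW Wxx & h = Wt - Wxx].

Section HeatOperator.
Context {R : realType}.
Implicit Types (W : R -> R -> R) (t x h e c s K : R).

Lemma heat_opB W1 W2 t x h1 h2 : heat_op W1 t x h1 -> heat_op W2 t x h2 ->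
  heat_op (fun s y => W1 s y - W2 s y) t x (h1 - h2).
Proof.
move=> [a1 [b1 [d1 [A1 B1 C1 ->]]]] [a2 [b2 [d2 [A2 B2 C2 ->]]]].
exists (a1 - a2), (b1 - b2), (fun y => d1 y - d2 y); split.
- exact: is_deriveB.
- by apply: filterS2 B1 B2 => y D1 D2; exact: is_deriveB.
- exact: is_deriveB.
- by ring.
Qed.

Lemma heat_op_near W1 W2 t x h : (\forall s \near t, W1 s x = W2 s x) ->
  (\forall y \near x, W1 t y = W2 t y) -> heat_op W1 t x h -> heat_op W2 t x h.
Proof.
move=> Et Ex [a1 [b1 [d1 [A1 B1 C1 ->]]]].
exists a1, b1, d1; split => //; first exact: near_eq_is_derive A1.
have {}Ex : \forall y \near x, \forall z \near y, W1 t z = W2 t z.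
  exact: near_join.
by apply: filterS2 Ex B1 => y Ey; exact: near_eq_is_derive.
Qed.

Lemma heat_op_reflect W c t x h : heat_op W t (c - x) h ->
  heat_op (fun s y => W s (c - y)) t x h.
Proof.
move=> [a1 [b1 [d1 [A1 B1 C1 ->]]]].
have dc y : is_derive y (1 : R) (fun z => c - z) (0 - 1) by exact: is_deriveB.
exists a1, b1, (fun y => - d1 (c - y)); split => //.
- have cc : (fun z => c - z) y @[y --> x] --> c - x.
    by apply: (@continuousB _ _ _ (cst c) id x); [exact: cvg_cst|exact: cvg_id].
  have {}B1 : nbhs x (fun y => is_derive (c - y) (1 : R) (W t) (d1 (c - y))) :=
    cc _ B1.
  apply: filterS B1 => y D1.
  have -> : - d1 (c - y) = d1 (c - y) * (0 - 1) by ring.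
  exact: (@is_derive1_comp _ (W t) (fun z => c - z)).
- have -> : b1 = - (b1 * (0 - 1)) by ring.
  by apply: is_deriveN; exact: (@is_derive1_comp _ d1 (fun z => c - z)).
Qed.

Lemma heat_op_shift W s t x h : heat_op W (t + s) x h ->
  heat_op (fun r y => W (r + s) y) t x h.
Proof.
move=> [a1 [b1 [d1 [A1 B1 C1 ->]]]].
exists a1, b1, d1; split => //.
rewrite -[a1]mulr1.
apply: (@is_derive1_comp _ (W ^~ x) (shift s)) => //; exact: is_derive_shift.
Qed.

(** The time condition gives [W_t <= K * W] and the space condition [W_xx >= 0]. The weight makes
    any rate [K] available, in order to beat the Lipschitz constant of the reaction. *)
Lemma heat_op_weighted_min W t x h K e : 0 < e -> heat_op W t x h ->
  (forall s, t - e < s < t ->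
     expR (- K * t) * W t x <= expR (- K * s) * W s x) ->
  (forall y, x - e < y < x + e -> W t x <= W t y) ->
  h <= K * W t x.
Proof.
move=> e0 [a1 [b1 [d1 [A1 B1 C1 ->]]]] tmin xmin.
have b0 : 0 <= b1 by exact: local_min_second_derive B1 C1 xmin.
have E : is_derive t (1 : R) (fun s => expR (- K * s)) (expR (- K * t) * (- K * 1)).
  exact: (@is_derive1_comp _ expR (fun s => - K * s)).
have := left_min_derive_le0 (is_deriveM E A1) e0 tmin.
rewrite /GRing.scale /= => D.
have : expR (- K * t) * (a1 - K * W t x) <= 0 by apply: le_trans D; lra.
rewrite pmulr_rle0 ?expR_gt0//; lra.
Qed.

End HeatOperator.

(** * Minima on rectangles and the comparison principle *)

Lemma rectangle_min (R : realType) (F : R -> R -> R) (p q r s : R) :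
  p <= q -> r <= s ->
  {within `[p, q] `*` `[r, s], continuous (fun z => F z.1 z.2)} ->
  exists t x, [/\ p <= t <= q, r <= x <= s &
    forall t' x', p <= t' <= q -> r <= x' <= s -> F t x <= F t' x'].
Proof.
move=> pq rs Fc.
have [||[t x] + tx] := compact_EVT_min _ _ Fc.
- by exists (p, r); rewrite /= !in_itv /= !lexx.
- by apply: compact_setX; exact: segment_compact.
rewrite inE /= !in_itv /= => -[tpq xrs]; exists t, x; split => // t' x' t'pq x'rs.
by apply: (tx (t', x')); rewrite inE /= !in_itv.
Qed.

Lemma rectangle_bounded (R : realType) (F : R -> R -> R) (p q r s : R) :
  {within `[p, q] `*` `[r, s], continuous (fun z => F z.1 z.2)} ->
  exists2 M : R, 0 < M & forall t x, p <= t <= q -> r <= x <= s -> `|F t x| <= M.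
Proof.
move=> Fc.
have [M M0 MP] := ex_strict_bound_gt0 (compact_bounded (continuous_compact Fc
  (compact_setX (@segment_compact _ _ _) (@segment_compact _ _ _)))).
exists M => // t x tpq xrs; apply/ltW/MP; exists (t, x) => //=.
Qed.

Section Comparison.
Context {R : realType}.

(** If [U - v] were negative somewhere, the weighted difference would have a negative minimum with
    [t > 0] and [p < x < q]. There the reaction terms bound [h1 - h2] below by [C * L * (U - v)],
    against the upper bound [K * (U - v)]. The differential inequalities are asked only where
    [U < v], and the coefficient [c] is left free so that it can be [V], a constant, or [0]. *)
Lemma comparison (a tau p q C : R) (c U v : R -> R -> R) :
  1 < a -> 0 <= tau -> p <= q -> 0 <= C ->
  {within `[0, tau] `*` `[p, q], continuous (fun z => U z.1 z.2)} ->
  {within `[0, tau] `*` `[p, q], continuous (fun z => v z.1 z.2)} ->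
  (forall t x, 0 <= t <= tau -> p <= x <= q -> 0 <= U t x) ->
  (forall t x, 0 < t <= tau -> p < x < q -> U t x < v t x ->
     0 <= c t x <= C /\ exists h1 h2, [/\ heat_op U t x h1, heat_op v t x h2,
       c t x * source a (U t x) <= h1 & h2 <= c t x * source a (v t x)]) ->
  (forall x, p <= x <= q -> v 0 x <= U 0 x) ->
  (forall t, 0 <= t <= tau -> v t p <= U t p) ->
  (forall t, 0 <= t <= tau -> v t q <= U t q) ->
  forall t x, 0 <= t <= tau -> p <= x <= q -> v t x <= U t x.
Proof.
move=> a1 tau0 pq C0 Uc vc U0 ineq init Lp Lq t x tt xx.
(* A bound for [v] suffices: wherever [U < v], both values lie in [[0, M]]. *)
have [M M0 vM] := rectangle_bounded vc.
have [L L0 fL] := source_lipschitz a1 (ltW M0).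
(* The extra [1] makes the contradiction strict at a negative minimum. *)
pose K := C * L + 1.
pose F (s y : R) := expR (- K * s) * (U s y - v s y).
have Fc : {within `[0, tau] `*` `[p, q], continuous (fun z => F z.1 z.2)}.
  move=> z; apply: (@continuousM _ (subspace _) (fun z => expR (- K * z.1))).
    apply: continuous_subspaceT => y.
    apply: (@continuous_comp _ _ _ (fun z => - K * z.1) expR).
      by apply: continuousM; [exact: cst_continuous|exact: cvg_fst].
    exact: continuous_expR.
  by apply: continuousB; [exact: Uc|exact: vc].
have [t0 [x0 [tt0 xx0 Fmin]]] := rectangle_min tau0 pq Fc.
suff F0 : 0 <= F t0 x0.
  have := le_trans F0 (Fmin _ _ tt xx).
  by rewrite pmulr_rge0 ?expR_gt0// subr_ge0.
rewrite leNgt; apply/negP => F0.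
have W0 : U t0 x0 < v t0 x0.
  by move: F0; rewrite pmulr_rlt0 ?expR_gt0// subr_lt0.
have t00 : 0 < t0.
  rewrite lt_neqAle; case/andP: tt0 => -> _; rewrite andbT eq_sym.
  by apply/negP => /eqP t0E; move: W0; rewrite t0E ltNge init.
have x0p : p < x0.
  rewrite lt_neqAle; case/andP: xx0 => -> _; rewrite andbT eq_sym.
  by apply/negP => /eqP E; move: W0; rewrite E ltNge Lp.
have x0q : x0 < q.
  rewrite lt_neqAle; case/andP: xx0 => _ ->; rewrite andbT.
  by apply/negP => /eqP E; move: W0; rewrite E ltNge Lq.
have [|//|//|/andP[c0 cC] [h1 [h2 [H1 H2 I1 I2]]]] := ineq t0 x0; [lra|lra|].
pose e := Num.min t0 (Num.min (x0 - p) (q - x0)).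
have e0 : 0 < e by rewrite !lt_min t00 !subr_gt0 x0p.
have e1 : e <= t0 by rewrite ge_min lexx.
have e2 : e <= x0 - p by rewrite !ge_min lexx orbT.
have e3 : e <= q - x0 by rewrite !ge_min lexx !orbT.
have : h1 - h2 <= K * (U t0 x0 - v t0 x0).
  apply: (heat_op_weighted_min e0 (heat_opB H1 H2)) => [s s1|y y1].
    by apply: Fmin => //; move: s1 e1 tt0; clear; lra.
  have yy : p <= y <= q by move: y1 e2 e3; clear; lra.
  by have := Fmin t0 y tt0 yy; rewrite ler_pM2l ?expR_gt0.
have U00 : 0 <= U t0 x0 by exact: U0.
have vM' : v t0 x0 <= M by exact: le_trans (ler_norm _) (vM _ _ tt0 xx0).
have fUv := fL _ _ U00 (ltW W0) vM'.
have : c t0 x0 * (source a (v t0 x0) - source a (U t0 x0)) <= C * (L * (v t0 x0 - U t0 x0)).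
  apply: le_trans (_ : c t0 x0 * (L * (v t0 x0 - U t0 x0)) <= _).
    exact: ler_wpM2l.
  by apply: ler_wpM2r => //; rewrite mulr_ge0// subr_ge0 ltW.
rewrite /K; lra.
Qed.

End Comparison.

(* The common hypotheses on [V] and [phi]. *)
Record profile {R : realType} (g : R -> R) : Prop := Profile {
  profile_ge0 : forall x, -1 <= x <= 1 -> 0 <= g x;
  profile_even : forall x, -1 <= x <= 1 -> g (- x) = g x;
  profile_antitone : forall x y, 0 <= x -> x <= y -> y <= 1 / 3 -> g y <= g x;
  profile_tail : forall x, 1 / 3 <= x <= 1 -> g x <= g (1 / 3) }.

(** * Order relations for profiles *)

Section Profile.
Context {R : realType}.
Implicit Types (g : R -> R) (x y : R).

Lemma nbhs_cI x : -1 < x < 1 -> nbhs x (@cI R).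
Proof.
move=> x1; have : x \in `](-1), 1[ by rewrite in_itv.
move/near_in_itvoo; apply: filterS => y; rewrite /cI /= !in_itv /= => /andP[? ?].
by apply/andP; split; exact: ltW.
Qed.

Lemma C1_on_antitone g : C1_on cI g ->
  (forall x, 0 <= x <= 1 / 3 -> derive_on cI g x <= 0) ->
  forall x y, 0 <= x -> x <= y -> y <= 1 / 3 -> g y <= g x.
Proof.
move=> [gd _] g'0 x y x0 xy y3.
have gD (z : R) : 0 <= z <= 1 / 3 -> is_derive z 1 g (derive_on cI g z).
  move=> z01; apply: derive_on_interior; last by apply: gd; rewrite /cI /= in_itv /=; lra.
  by apply: nbhs_cI; lra.
have gc : {within `[x, y], continuous g}.
  apply: derivable_within_continuous => z; rewrite in_itv /= => zxy.
  by have [] := gD z ltac:(lra).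
have gxy (z : R) : z \in `]x, y[ -> is_derive z 1 g (derive_on cI g z).
  by rewrite in_itv /= => zxy; apply: gD; lra.
have [z + E] := MVT_segment xy gxy gc; rewrite in_itv /= => zxy.
by rewrite -subr_le0 E mulr_le0_ge0// ?g'0//; lra.
Qed.

Lemma profile_le_abs g x y : profile g -> `|x| <= y -> y <= 1 / 3 -> g y <= g x.
Proof.
move=> bg; have [x0|x0] := leP 0 x.
  by rewrite ger0_norm// => xy y3; exact: profile_antitone.
rewrite ltr0_norm// => xy y3; rewrite -(profile_even bg (x := x)); last lra.
apply: profile_antitone => //; lra.
Qed.

Lemma profile_le_center g x : profile g -> -1 <= x <= 1 -> g x <= g 0.
Proof.
move=> bg.
have pos y : 0 <= y -> y <= 1 -> g y <= g 0.
  move=> y0 y1; have [y3|y3] := leP y (1 / 3).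
    by apply: profile_antitone => //; lra.
  apply: le_trans (profile_tail bg (x := y) ltac:(lra)) _.
  by apply: profile_antitone => //; lra.
move=> x1; have [x0|x0] := leP 0 x; first by apply: pos; lra.
by rewrite -(profile_even bg x1); apply: pos; lra.
Qed.

(** The reflected point lies in [[-1/3, 1/3]], where [g] is at least [g (1 / 3)]. *)
Lemma profile_le_reflect g x : profile g -> 1 / 3 <= x <= 1 -> g x <= g (2 / 3 - x).
Proof.
move=> bg x1; apply: le_trans (profile_tail bg x1) _.
apply: profile_le_abs => //; rewrite ler_norml; lra.
Qed.

End Profile.

(** * Direct consequences of the definition of a solution *)

Section Solution.
Context {R : realType}.
Variables (a : R) (V u0 : R -> R) (T : \bar R) (u : R -> R -> R).
Hypothesis usol : classical_solution a V u0 T u.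

Lemma solution_rectangle tau p q : (tau%:E < T)%E -> -1 <= p -> q <= 1 ->
  {within `[0, tau] `*` `[p, q], continuous (fun z => u z.1 z.2)}.
Proof.
move=> tauT p1 q1; apply: continuous_subspaceW (sol_continuous usol).
move=> [t x] /=; rewrite /cylinder /cI /= !in_itv /= => -[/andP[t0 tt] xx].
split=> //; split; last by lra.
by apply: le_lt_trans tauT; rewrite lee_fin.
Qed.

Lemma solution_shift_rectangle tau h p q : 0 <= h -> ((tau + h)%:E < T)%E ->
  -1 <= p -> q <= 1 ->
  {within `[0, tau] `*` `[p, q], continuous (fun z => u (z.1 + h) z.2)}.
Proof.
move=> h0 tauT p1 q1; have uc := solution_rectangle tauT p1 q1.
apply: (@continuous_within_comp _ _ _ _ (`[0, tau] `*` `[p, q]) _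
    (fun z => (z.1 + h, z.2)) uc).
  apply/continuous_subspaceT/continuous_pair => z; last exact: cvg_snd.
  by apply: cvgD; [exact: cvg_fst|exact: cvg_cst].
by move=> [s y] /=; rewrite !in_itv /= => -[st ypq]; split=> //; lra.
Qed.

Lemma solution_heat_op t x : 0 < t -> (t%:E < T)%E -> -1 < x < 1 ->
  heat_op u t x (V x * source a (u t x)).
Proof.
move=> t0 tT x1.
have tc (y : R) : -1 < y < 1 -> open_cylinder T (t, y).
  by move=> y1; split => //; split => //=; rewrite /cI /= in_itv /=; lra.
exists (u_t u t x), (u_xx u t x), (u_x u t); split.
- rewrite /u_t derive1E; apply: derivableP.
  by refine (sol_derivable_t usol (tc _ x1)).
- have : \forall y \near x, y \in `](-1), 1[ by apply: near_in_itvoo; rewrite in_itv.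
  apply: filterS => y; rewrite in_itv /= => y1.
  by apply: derive_on_interior; [exact: nbhs_cI|by refine (sol_derivable_x usol (tc _ y1))].
- by apply: derive_on_interior; [exact: nbhs_cI|by refine (sol_derivable_xx usol (tc _ x1))].
- by rewrite (sol_pde usol)//; ring.
Qed.

(** Boundary values are prescribed only for [t > 0]; continuity on the cylinder, which contains
    [t = 0], carries them to the corners. *)
Lemma solution_boundary t : 0 <= t -> (t%:E < T)%E -> u t (-1) = 0 /\ u t 1 = 0.
Proof.
have key y : cI y -> (forall s, 0 < s -> (s%:E < T)%E -> u s y = 0) -> u 0 y = 0.
  move=> y1 us0; have [tau tau0 tauT] : exists2 tau, 0 < tau & (tau%:E < T)%E.
    have := sol_time_gt0 usol; case: T => [r|_|//]; last by exists 1 => //; rewrite ltry.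
    by rewrite lte_fin => r0; exists (r / 2); rewrite ?lte_fin; lra.
  have yc : {within `[0, tau], continuous (fun s => u s y)}.
    have uc := solution_rectangle tauT (lexx _) (lexx _).
    apply: (@continuous_within_comp _ _ _ _ `[0, tau] _ (fun s => (s, y)) uc).
      by apply/continuous_subspaceT/continuous_pair => s; [exact: cvg_id|exact: cvg_cst].
    by move=> s.
  have [_ + _] := (continuous_within_itvP _ tau0).1 yc.
  move=> yc0.
  have E : u s y @[s --> 0^'+] --> (0 : R).
    apply: cvg_near_cst; near=> s; apply: us0.
      by near: s; exact: nbhs_right_gt.
    apply: le_lt_trans tauT; rewrite lee_fin.
    by near: s; exact: nbhs_right_le.
  exact: (cvg_unique _ yc0 E).
rewrite le_eqVlt => /orP[/eqP <- _|t0 tT]; last exact: (sol_boundary usol t0 tT).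
split; apply: key => [|s s0 sT]; rewrite /cI /= ?in_itv /=; try lra.
  by case: (sol_boundary usol s0 sT).
by case: (sol_boundary usol s0 sT).
Unshelve. all: by end_near. Qed.

Lemma solution_ge0 t x : 0 <= t -> (t%:E < T)%E -> -1 <= x <= 1 -> 0 <= u t x.
Proof.
by move=> t0 tT x1; apply: (sol_ge0 usol); split => //; split; rewrite // /cI /= in_itv.
Qed.

End Solution.

(** * Reflection comparisons *)

Section SymmetricDecreasing.
Context {R : realType}.
Variables (a : R) (V u0 : R -> R) (T : \bar R) (u : R -> R -> R).
Hypotheses (a1 : 1 < a) (usol : classical_solution a V u0 T u).
Hypotheses (bV : profile V) (bu0 : profile u0) (u01 : u0 1 = 0).

Lemma solution_initial (x : R) : -1 <= x <= 1 -> u 0 x = u0 x.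
Proof.
move=> x1; have [um up] := solution_boundary usol (lexx _) (sol_time_gt0 usol).
have [->|xp] := eqVneq x 1; first by rewrite up u01.
have [->|xm] := eqVneq x (-1).
  by rewrite um (profile_even bu0)// ?u01//; lra.
by apply: (sol_initial usol); rewrite !lt_neqAle xp eq_sym xm.
Qed.

(** On [[p, q]] the reflection [u t (c - x)] solves the equation with the larger coefficient
    [V (c - x)], hence is a supersolution. It is used with [c = 0] on [[-1, 1]] for evenness, and
    with [c = 2 / 3] on [[1/3, 1]]. *)
Lemma solution_le_reflect (c p q : R) : -1 <= p -> p <= q -> q <= 1 ->
  -1 <= c - q -> c - p <= 1 ->
  (forall x : R, p < x < q -> V x <= V (c - x)) ->
  (forall x : R, p <= x <= q -> u0 x <= u0 (c - x)) ->
  (forall t : R, 0 <= t -> (t%:E < T)%E -> u t p <= u t (c - p)) ->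
  (forall t : R, 0 <= t -> (t%:E < T)%E -> u t q <= u t (c - q)) ->
  forall t x : R, 0 <= t -> (t%:E < T)%E -> p <= x <= q -> u t x <= u t (c - x).
Proof.
move=> p1 pq q1 cq cp Vle u0le uple uqle t x t0 tT xpq.
have sT (s : R) : s <= t -> (s%:E < T)%E.
  by move=> st; apply: le_lt_trans tT; rewrite lee_fin.
have V00 : 0 <= V 0 by apply: (profile_ge0 bV); lra.
apply: (@comparison R a t p q (V 0) (fun _ => V) (fun s y => u s (c - y)) u) => //;
  rewrite ?t0 ?lexx //.
- have uc := solution_rectangle usol tT cq cp.
  apply: (@continuous_within_comp _ _ _ _ (`[0, t] `*` `[p, q]) _
    (fun z => (z.1, c - z.2)) uc).
    apply/continuous_subspaceT/continuous_pair => z; first exact: cvg_fst.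
    by apply: cvgB; [exact: cvg_cst|exact: cvg_snd].
  by move=> [s y] /=; rewrite !in_itv /= => -[st ypq]; split=> //; lra.
- by refine (solution_rectangle usol tT p1 q1).
- move=> s y st ypq; apply: (solution_ge0 usol); [lra| |lra].
  by apply: sT; lra.
- move=> s y st ypq Uv; have sT' : (s%:E < T)%E by apply: sT; lra.
  split.
    by apply/andP; split; [apply: (profile_ge0 bV)|apply: (profile_le_center bV)]; lra.
  exists (V (c - y) * source a (u s (c - y))), (V y * source a (u s y)); split=> //.
  + by apply/heat_op_reflect/(solution_heat_op usol) => //; lra.
  + by apply: (solution_heat_op usol) => //; lra.
  + apply: ler_wpM2r; last exact: Vle.
    by apply/source_ge0/(solution_ge0 usol) => //; lra.
- move=> y ypq; rewrite !solution_initial; [exact: u0le|lra|lra].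
- by move=> s st; apply: uple; [lra|apply: sT; lra].
- by move=> s st; apply: uqle; [lra|apply: sT; lra].
Qed.

Lemma solution_even (t x : R) : 0 <= t -> (t%:E < T)%E -> -1 <= x <= 1 ->
  u t (- x) = u t x.
Proof.
have key (s y : R) : 0 <= s -> (s%:E < T)%E -> -1 <= y <= 1 -> u s y <= u s (- y).
  move=> s0 sT y1; rewrite -sub0r; apply: (@solution_le_reflect 0 (-1) 1) => //; try lra.
  - by move=> z z1; rewrite sub0r (profile_even bV)//; lra.
  - by move=> z z1; rewrite sub0r (profile_even bu0)//; lra.
  - by move=> r r0 rT; rewrite sub0r opprK; have [-> ->] := solution_boundary usol r0 rT.
  - by move=> r r0 rT; rewrite sub0r; have [-> ->] := solution_boundary usol r0 rT.
move=> t0 tT x1; apply/eqP; rewrite eq_le key// andbT.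
by rewrite -[leRHS](congr1 (u t) (opprK x)) key//; lra.
Qed.

Lemma solution_le_reflect_third (t x : R) : 0 <= t -> (t%:E < T)%E -> 1 / 3 <= x <= 1 ->
  u t x <= u t (2 / 3 - x).
Proof.
move=> t0 tT x1; apply: (@solution_le_reflect (2 / 3) (1 / 3) 1) => //; try lra.
- by move=> z z1; apply: profile_le_reflect => //; lra.
- by move=> z z1; exact: profile_le_reflect.
- by move=> s s0 sT; rewrite (_ : 2 / 3 - 1 / 3 = 1 / 3)//; lra.
- move=> s s0 sT; have [_ ->] := solution_boundary usol s0 sT.
  by apply: (solution_ge0 usol) => //; lra.
Qed.

(** A positive derivative would violate [u t (1/3 + s) <= u t (1/3 - s)] for small [s]. This
    supplies the condition on the edge [y = 1 / 3] of the triangle. *)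
Lemma solution_derive_third (t : R) : 0 < t -> (t%:E < T)%E ->
  exists2 d : R, is_derive (1 / 3 : R) (1 : R) (u t) d & d <= 0.
Proof.
move=> t0 tT.
have [|a2 [b2 [d2 [_ /nbhs_singleton D _ _]]]] :=
  solution_heat_op usol (x := 1 / 3) t0 tT; first lra.
exists (d2 (1 / 3)) => //; rewrite leNgt; apply/negP => d0.
have [e e0 eP] := is_derive_gt0 D d0.
pose s := Num.min e (2 / 3) / 2.
have m0 : 0 < Num.min e (2 / 3) by rewrite lt_min e0/=; lra.
have m1 : Num.min e (2 / 3) <= e by rewrite ge_min lexx.
have m2 : Num.min e (2 / 3) <= 2 / 3 by rewrite ge_min lexx orbT.
have [_ R1] := eP (1 / 3 + s); have [R2 _] := eP (1 / 3 - s).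
have := @solution_le_reflect_third t (1 / 3 + s) (ltW t0) tT ltac:(rewrite /s; lra).
rewrite (_ : 2 / 3 - (1 / 3 + s) = 1 / 3 - s); last lra.
have := R1 ltac:(rewrite /s; lra); have := R2 ltac:(rewrite /s; lra); lra.
Qed.

End SymmetricDecreasing.

(** * Two-point comparison on a triangle *)

Definition triangle {R : realType} (tau r : R) : set (R * (R * R)) :=
  [set z | [/\ 0 <= z.1 <= tau, `|z.2.1| <= z.2.2 & z.2.2 <= r]].

Lemma triangle_min (R : realType) (tau r : R) (F : R * (R * R) -> R) :
  0 <= tau -> 0 <= r ->
  {within triangle tau r, continuous F} ->
  exists s z w, [/\ 0 <= s <= tau, `|z| <= w, w <= r &
    forall s' z' w', 0 <= s' <= tau -> `|z'| <= w' -> w' <= r ->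
      F (s, (z, w)) <= F (s', (z', w'))].
Proof.
move=> tau0 r0 Fc; set D := triangle tau r in Fc.
have D0 : D (0, (0, 0)) by split; rewrite ?normr0 ?lexx.
have proj1 : continuous (fun z : R * (R * R) => z.2.1).
  by move=> z; apply: (@continuous_comp _ _ _ snd fst); [exact: cvg_snd|exact: cvg_fst].
have proj2 : continuous (fun z : R * (R * R) => z.2.2).
  by move=> z; apply: (@continuous_comp _ _ _ snd snd); exact: cvg_snd.
have DE : D = (`[0, tau] `*` (`[- r, r] `*` `[0, r])) `&`
    [set z : R * (R * R) | 0 <= z.2.2 - `|z.2.1|].
  apply/seteqP; split=> -[s [z w]]; rewrite /= !in_itv /= subr_ge0; last first.
    by move=> [[st [_ /andP[_ wr]]] zw].
  move=> [st zw wr]; split => //; split => //; split.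
    by rewrite -ler_norml; exact: le_trans wr.
  by rewrite wr andbT; exact: le_trans zw.
have Dcompact : compact D.
  rewrite DE; apply: compact_closedI.
    by do 2 (apply: compact_setX; first exact: segment_compact); exact: segment_compact.
  apply: (@closed_comp _ _ (fun z : R * (R * R) => z.2.2 - `|z.2.1|)
    [set r | 0 <= r]); last exact: closed_ge.
  move=> z _; apply: (@continuousB _ _ _ (fun z : R * (R * R) => z.2.2)).
    exact: proj2.
  by apply: (@continuous_comp _ _ _ (fun z : R * (R * R) => z.2.1)
    (fun r : R => `|r|)); [exact: proj1|exact: norm_continuous].
have [[s [z w]] + Fmin] := compact_EVT_min (ex_intro _ _ D0) Dcompact Fc.
rewrite inE => -[st zw wr]; exists s, z, w; split=> // s' z' w' ? ? ?.
by apply: Fmin; rewrite inE.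
Qed.

(** The letters name the values of [V], [source a] and [u] at two points [z] and [w]. The larger
    coefficient at [z] only helps, so the loss comes from the Lipschitz bound alone. *)
Lemma monotone_reaction (R : realType) (V0 Vz Vw L fz fw uz uw : R) :
  0 <= L -> uz <= uw -> Vw <= Vz -> 0 <= Vw -> Vw <= V0 -> 0 <= fz ->
  fw - fz <= L * (uw - uz) -> V0 * L * (uz - uw) <= Vz * fz - Vw * fw.
Proof.
move=> L0 uzw Vwz Vw0 VwV0 fz0 lip.
have P1 : Vw * fz <= Vz * fz by rewrite ler_wpM2r.
have P2 : Vw * (fw - fz) <= Vw * (L * (uw - uz)) by exact: ler_wpM2l.
have P3 : Vw * (L * (uw - uz)) <= V0 * (L * (uw - uz)).
  by rewrite ler_wpM2r// mulr_ge0// subr_ge0.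
lra.
Qed.

(* Minimum principle for [u(t, x) - u(t, y)] on the triangle
   [|x| <= y <= 1/3]. It vanishes for [|x| = y], while the sign of the
   derivative at [1/3] excludes minima with [y = 1/3] once the increasing
   function [eps * (1 + y)] is added. *)
Lemma solution_le_abs (R : realType) (a : R) (V u0 : R -> R) (T : \bar R)
    (u : R -> R -> R) : 1 < a -> classical_solution a V u0 T u ->
  profile V -> profile u0 -> u0 1 = 0 -> forall t x y : R, 0 <= t -> (t%:E < T)%E ->
  `|x| <= y -> y <= 1 / 3 -> u t y <= u t x.
Proof.
move=> a1 usol bV bu0 u01 t x y t0 tT xy y3.
have sT (s : R) : s <= t -> (s%:E < T)%E.
  by move=> st; apply: le_lt_trans tT; rewrite lee_fin.
have uc := solution_rectangle usol tT (lexx _) (lexx _).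
have [M M0 uM] := rectangle_bounded uc.
have [L L0 fL] := source_lipschitz a1 (ltW M0).
have V00 : 0 <= V 0 by apply: (profile_ge0 bV); lra.
pose k := V 0 * L + 1.
have [E [E0 ED]] : exists E : R -> R,
    (forall s, 0 < E s) /\ (forall s, is_derive s (1 : R) E (E s * (- k * 1))).
  exists (fun s => expR (- k * s)); split=> s; first exact: expR_gt0.
  exact: (@is_derive1_comp _ expR (fun s => - k * s)).
have proj1 : continuous (fun z : R * (R * R) => z.2.1).
  by move=> z; apply: (@continuous_comp _ _ _ snd fst); [exact: cvg_snd|exact: cvg_fst].
have proj2 : continuous (fun z : R * (R * R) => z.2.2).
  by move=> z; apply: (@continuous_comp _ _ _ snd snd); exact: cvg_snd.
pose W (s z w : R) := u s z - u s w.
suff main eps : 0 < eps -> 0 <= E t * W t x y + eps * (1 + y).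
  rewrite -subr_ge0 -(pmulr_rge0 _ (E0 t)) leNgt; apply/negP => neg.
  (* As [1 + y <= 2], this perturbation compensates at most half of the negative value. *)
  pose eps := - (E t * W t x y) / 4.
  have y0 : 0 <= y by exact: le_trans xy.
  have := main eps; rewrite /eps; move: neg; rewrite -/(W t x y).
  move: (E t * W t x y) => m m0 /(_ ltac:(lra)).
  have : - m / 4 * (1 + y) <= - m / 4 * 2 by rewrite ler_wpM2l; lra.
  lra.
move=> eps0.
(* The perturbation stands outside the factor [E] and is affine in the second point: it drops out of
   the time derivative and of the second space derivatives, and is felt only in the first derivative
   at [1 / 3]. *)
pose F (z : R * (R * R)) := E z.1 * W z.1 z.2.1 z.2.2 + eps * (1 + z.2.2).
have Fc : {within triangle t (1 / 3), continuous F}.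
  set D := triangle _ _.
  have uproj (g : R * (R * R) -> R) : continuous g ->
      (forall z, D z -> -1 <= g z <= 1) ->
      {within D, continuous (fun z => u z.1 (g z))}.
    move=> gc g1; apply: (@continuous_within_comp _ _ _ _ D _
      (fun z => (z.1, g z)) uc).
      by apply/continuous_subspaceT/continuous_pair => // z; exact: cvg_fst.
    move=> [s [z w]] Dz; have := g1 _ Dz; have [st _ _] := Dz.
    by rewrite /= !in_itv.
  have Wc : {within D, continuous (fun z => W z.1 z.2.1 z.2.2)}.
    move=> z; apply: (@continuousB _ _ (subspace D) (fun z => u z.1 z.2.1));
      apply: uproj => // -[s [q w]] [_ /= + ?].
      by rewrite ler_norml; lra.
    by move/(le_trans (normr_ge0 _)); lra.
  move=> z; apply: (@continuousD _ _ (subspace D)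
    (fun z => E z.1 * W z.1 z.2.1 z.2.2)).
    apply: (@continuousM _ (subspace D) (fun z => E z.1)); last exact: Wc.
    apply: continuous_subspaceT => q.
    apply: (@continuous_comp _ _ _ fst E); first exact: cvg_fst.
    by have [/derivable1_diffP/differentiable_continuous] := ED q.1.
  apply: continuous_subspaceT => q.
  apply: (@continuousM _ _ (fun=> eps) (fun z : R * (R * R) => 1 + z.2.2)).
    exact: cst_continuous.
  by apply: (@continuousD _ _ _ (fun=> (1 : R)) (fun z : R * (R * R) => z.2.2));
    [exact: cst_continuous|exact: proj2].
have [|s [z [w [st zw w3 Fmin]]]] := triangle_min t0 _ Fc; first lra.
clear Fc proj1 proj2.
suff F0 : 0 <= F (s, (z, w)).
  by apply: le_trans F0 (Fmin t x y _ xy y3); rewrite t0 /=.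
rewrite leNgt; apply/negP => Flt.
have w0 : 0 <= w by exact: le_trans zw.
have Fs : E s * W s z w + eps * (1 + w) < 0 by exact: Flt.
have W0 : W s z w < 0.
  have : 0 < eps * (1 + w) by rewrite mulr_gt0//; lra.
  by rewrite -(pmulr_rlt0 _ (E0 s)); lra.
have s0 : 0 < s.
  rewrite lt_neqAle; case/andP: st => -> _; rewrite andbT eq_sym.
  apply/negP => /eqP sE; move: W0; rewrite sE ltNge subr_ge0.
  move: zw; rewrite ler_norml => zw'.
  rewrite !(solution_initial usol bu0 u01) ?(profile_le_abs bu0)//; try lra.
  by rewrite ler_norml.
have sT' : (s%:E < T)%E by apply: sT; lra.
have zltw : `|z| < w.
  rewrite lt_neqAle zw andbT; apply/negP => /eqP wE; move: W0.
  rewrite -wE /W; have [z0|z0] := leP 0 z; first by rewrite ger0_norm// subrr ltxx.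
  rewrite ltr0_norm// (solution_even a1 usol bV bu0 u01) ?subrr ?ltxx//; try lra.
  by move: zw; rewrite ler_norml; lra.
have wlt3 : w < 1 / 3.
  rewrite lt_neqAle w3 andbT; apply/negP => /eqP wE.
  have [d ud d0] := solution_derive_third a1 usol bV bu0 u01 s0 sT'.
  have FD : is_derive w (1 : R) (fun w => E s * (u s z - u s w) + eps * (1 + w))
      (E s * (0 - d) + eps * (0 + 1)).
    by rewrite wE; apply: is_deriveD; apply: is_deriveZ.
  have wz0 : 0 < w - `|z| by rewrite subr_gt0.
  have : E s * (0 - d) + eps * (0 + 1) <= 0.
    by apply: (left_min_derive_le0 FD wz0) => w' w'w; apply: Fmin => //;
      move: w'w w3; clear; lra.
  have : 0 <= E s * - d by rewrite mulr_ge0 ?oppr_ge0// ltW.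
  lra.
have z1 : -1 < z < 1 by rewrite -ltr_norml; move: zltw w3; clear; lra.
have z1' : -1 <= z <= 1 by move: z1; clear; lra.
have w1 : -1 < w < 1 by move: w0 w3; clear; lra.
have w1' : -1 <= w <= 1 by move: w1; clear; lra.
have [b1 [c1 [d1 [B1 C1 D1 h1]]]] := solution_heat_op usol s0 sT' z1.
have [b2 [c2 [d2 [B2 C2 D2 h2]]]] := solution_heat_op usol s0 sT' w1.
have c1ge0 : 0 <= c1.
  have e0 : 0 < w - `|z| by rewrite subr_gt0.
  apply: (local_min_second_derive e0 C1 D1) => z' z'z.
  have := Fmin s z' w st _ w3; rewrite /F /= lerD2r ler_pM2l// lerD2r; apply.
  have := ler_norm z; have := ler_norm (- z); rewrite normrN => ? ?.
  by rewrite ler_norml; lra.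
have c2le0 : c2 <= 0.
  pose e := Num.min (w - `|z|) (1 / 3 - w).
  have e0 : 0 < e by rewrite lt_min !subr_gt0 zltw.
  have e1 : e <= w - `|z| by rewrite ge_min lexx.
  have e2 : e <= 1 / 3 - w by rewrite ge_min lexx orbT.
  have C : \forall q \near w, is_derive (q : R) (1 : R)
      (fun w => E s * (u s z - u s w) + eps * (1 + w))
      (E s * (0 - d2 q) + eps * (0 + 1)).
    apply: filterS C2 => q C2q.
    by apply: is_deriveD; apply: is_deriveZ.
  have D' : is_derive w (1 : R) (fun q => E s * (0 - d2 q) + eps * (0 + 1))
      (E s * (0 - c2) + 0).
    by apply: is_deriveD; apply: is_deriveZ.
  have : 0 <= E s * (0 - c2) + 0.
    by apply: (local_min_second_derive e0 C D') => w' w'w; apply: Fmin => //;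
      move: w'w e1 e2; clear; lra.
  by rewrite addr0 sub0r pmulr_rge0// oppr_ge0.
have tmin : b1 - b2 <= k * W s z w.
  have P : E s * (b1 - b2) + W s z w * (E s * (- k * 1)) <= 0.
    apply: (left_min_derive_le0 (is_deriveM (ED s) (is_deriveB B1 B2)) s0) => s' s's.
    have s't : 0 <= s' <= t by move: s's st; clear; lra.
    by have := Fmin s' z w s't zw w3; rewrite /F /= lerD2r.
  have : E s * (b1 - b2 - k * W s z w) <= 0 by lra.
  by rewrite pmulr_rle0// subr_le0.
have uw0 : 0 <= u s z by exact: (solution_ge0 usol (ltW s0) sT' z1').
have uwM : u s w <= M by exact: le_trans (ler_norm _) (uM _ _ st w1').
have uzw : u s z <= u s w by rewrite -subr_le0; exact: ltW.
have f1 := fL _ _ uw0 uzw uwM.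
have Vzw : V w <= V z by exact: profile_le_abs.
have Vw0 : 0 <= V w by exact: (profile_ge0 bV w1').
have VwV0 : V w <= V 0 by exact: (profile_le_center bV w1').
have fz0 : 0 <= source a (u s z) by exact: source_ge0.
have := monotone_reaction L0 uzw Vzw Vw0 VwV0 fz0 f1.
move: tmin W0 h1 h2 c1ge0 c2le0; rewrite /k /W; clear; lra.
Qed.

Lemma solution_le_center (R : realType) (a : R) (V u0 : R -> R) (T : \bar R)
    (u : R -> R -> R) : 1 < a -> classical_solution a V u0 T u ->
  profile V -> profile u0 -> u0 1 = 0 -> forall t x : R, 0 <= t ->
  (t%:E < T)%E -> -1 <= x <= 1 -> u t x <= u t 0.
Proof.
move=> a1 usol bV bu0 u01 t x t0 tT.
have near (y : R) : `|y| <= 1 / 3 -> u t y <= u t 0.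
  move=> y3; have -> : u t y = u t `|y|.
    have [y0|y0] := leP 0 y; first by rewrite ger0_norm.
    rewrite ltr0_norm// (solution_even a1 usol bV bu0 u01)//.
    by move: y3; rewrite ler_norml; lra.
  by apply: (solution_le_abs a1 usol bV bu0 u01); rewrite ?normr0.
have pos (y : R) : 0 <= y <= 1 -> u t y <= u t 0.
  move=> y1; have [y3|y3] := leP y (1 / 3).
    by apply: near; rewrite ler_norml; lra.
  apply: le_trans (near (2 / 3 - y) _).
    by apply: (solution_le_reflect_third a1 usol bV bu0 u01) => //; lra.
  by rewrite ler_norml; lra.
move=> x1; have [x0|x0] := leP 0 x; first by apply: pos; lra.
by rewrite -(solution_even a1 usol bV bu0 u01)//; apply: pos; lra.
Qed.

(** * Growth rate at the center *)

Section CenterRate.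
Context {R : realType}.
Variables (a : R) (V u0 : R -> R) (T : R) (u : R -> R -> R).
Hypotheses (ha : 1 < a < 2) (usol : classical_solution a V u0 T%:E u).

Hypotheses (bV : profile V) (bu0 : profile u0) (u01 : u0 1 = 0).
Hypothesis blowup : sup (u t @` cI) @[t --> T^'-] --> +oo.

Lemma center_blowup : u t 0 @[t --> T^'-] --> +oo.
Proof.
have a1 : 1 < a by case/andP: ha.
have T0 : 0 < T by have := sol_time_gt0 usol; rewrite lte_fin.
apply/cvgryPge => A.
have supA : \forall t \near T^'-, A <= sup (u t @` cI) by exact: (cvgryPge _).1 blowup A.
near=> t.
have t0 : 0 < t by near: t; exact: nbhs_left_gt.
have tT : t < T by near: t; exact: nbhs_left_lt.
apply: (@le_trans _ _ (sup (u t @` cI))); first by near: t.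
apply: ge_sup; first by exists (u t 0), 0 => //; rewrite /cI /= in_itv /=; lra.
move=> _ [x + <-]; rewrite /cI /= in_itv /= => x1.
by apply: (solution_le_center a1 usol bV bu0 u01) => //; rewrite ?lte_fin// ltW.
Unshelve. all: by end_near. Qed.

(** With [l = log (1 + u t 0)], the function [z = l ^ (1 - a)] satisfies [z' >= - (a - 1) * V 0] and
    tends to [0] at [T], so [z <= 2 * c * (T - t)]. Then [l * (T - t) >= l ^ (2 - a) / (2 * c)],
    which is unbounded because [a < 2]; only the bound [1] is kept. *)
Lemma center_rate :
  \forall t \near T^'-, 1 <= ln (1 + u t 0) * (T - t).
Proof.
have [a1 a2] := andP ha.
have T0 : 0 < T by have := sol_time_gt0 usol; rewrite lte_fin.
have V00 : 0 <= V 0 by apply: (profile_ge0 bV); lra.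
pose l t := ln (1 + u t 0).
have linf B : \forall t \near T^'-, B <= l t.
  have lB : \forall t \near T^'-, expR B <= u t 0.
    exact: (cvgryPge _).1 center_blowup (expR B).
  apply: filterS lB => t lt.
  have eB := expR_gt0 B.
  by rewrite -[B](@expRK R) ler_ln ?posrE//; lra.
(* The added [1] keeps [c] positive, as only [0 <= V 0] is available here. *)
pose c := (a - 1) * V 0 + 1.
have c0 : 0 < c by rewrite /c ltr_wpDl// mulr_ge0//; lra.
have [t1 /andP[t10 t1T] lt1] : exists2 t1, 0 < t1 < T & forall t, t1 <= t < T -> 1 <= l t.
  have := linf 1; rewrite /at_left near_withinE => /nbhs_ballP[e /= e0 eP].
  pose m := Num.min e T.
  have m0 : 0 < m by rewrite lt_min e0.
  have me : m <= e by rewrite ge_min lexx.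
  have mT : m <= T by rewrite ge_min lexx orbT.
  exists (T - m / 2); first lra.
  move=> t tT; apply: eP; last by lra.
  by rewrite /ball /= gtr0_norm; lra.
pose z t := l t `^ (1 - a).
have zle t s : t1 <= t -> t <= s -> s < T -> z t <= z s + c * (s - t).
  move=> t1t ts sT.
  have zd r : t1 <= r < T -> exists2 d, is_derive r (1 : R) z d & - c <= d.
    move=> rT; have r0 : 0 < r by lra.
    have rT' : (r%:E < T%:E)%E by rewrite lte_fin; lra.
    have l1 : 1 <= l r by exact: lt1.
    have [|b1 [b2 [d [B1 B2 D ub]]]] := solution_heat_op usol (x := 0) r0 rT'; first lra.
    have u00 : 0 <= u r 0 by apply: (solution_ge0 usol) => //; lra.
    (* The maximum in space at [0] discards diffusion and leaves an upper bound for the time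
       derivative. *)
    have b2le0 : b2 <= 0.
      have D' : is_derive (0 : R) (1 : R) (fun y => - d y) (- b2) by exact: is_deriveN.
      have B2' : \forall y \near (0 : R), is_derive (y : R) (1 : R) (fun y => - u r y) (- d y).
        by apply: filterS B2 => y; exact: is_deriveN.
      rewrite -oppr_ge0; apply: (local_min_second_derive ltr01 B2' D') => y y1.
      rewrite lerN2; apply: (solution_le_center a1 usol bV bu0 u01) => //; lra.
    have L1 : is_derive r (1 : R) (fun s => 1 + u s 0) (0 + b1) by exact: is_deriveD.
    have L2 : is_derive r (1 : R) l ((1 + u r 0)^-1 * (0 + b1)).
      apply: (@is_derive1_comp _ (@ln R) (fun s => 1 + u s 0)).
      by apply: is_derive1_ln; lra.
    have L3 : is_derive r (1 : R) z
        (((1 - a) * l r `^ (1 - a - 1)) * ((1 + u r 0)^-1 * (0 + b1))).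
      apply: (@is_derive1_comp _ (@powR R ^~ (1 - a)) l).
      by apply: is_derive1_powR; lra.
    exists (((1 - a) * l r `^ (1 - a - 1)) * ((1 + u r 0)^-1 * (0 + b1))) => //.
    have powE : l r `^ (1 - a - 1) * l r `^ a = 1.
      rewrite -powRD; last by apply/implyP => _; apply/eqP; lra.
      by rewrite (_ : 1 - a - 1 + a = 0) ?powRr0//; lra.
    set P := l r `^ (1 - a - 1) in powE *.
    have P0 : 0 <= P by exact: powR_ge0.
    set Q := l r `^ a in powE *.
    have b1le : b1 <= V 0 * (u r 0 * Q) by rewrite /source -/(l r) -/Q in ub; lra.
    have uinv : (1 + u r 0)^-1 * u r 0 <= 1 by rewrite mulrC ler_pdivrMr; lra.
    have I0 : 0 <= (1 + u r 0)^-1 by rewrite invr_ge0; lra.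
    have S1 : P * ((1 + u r 0)^-1 * b1) <= P * ((1 + u r 0)^-1 * (V 0 * (u r 0 * Q))).
      by do 2 (apply: ler_wpM2l => //).
    have S2 : P * ((1 + u r 0)^-1 * (V 0 * (u r 0 * Q))) = V 0 * ((1 + u r 0)^-1 * u r 0).
      by rewrite -[RHS]mulr1 -powE; ring.
    have S3 : V 0 * ((1 + u r 0)^-1 * u r 0) <= V 0 * 1 by exact: ler_wpM2l.
    have S4 : (a - 1) * (P * ((1 + u r 0)^-1 * b1)) <= (a - 1) * V 0.
      by apply: ler_wpM2l; lra.
    rewrite /c; lra.
  pose dz r := 'D_1 z r.
  have zc : {within `[t, s], continuous z}.
    apply: derivable_within_continuous => r; rewrite in_itv /= => rs.
    by have [|d [] //] := zd r; lra.
  have zD r : r \in `]t, s[ -> is_derive r (1 : R) z (dz r).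
    rewrite in_itv /= => rs; have [|d [zr _] _] := zd r; first lra.
    exact: derivableP.
  have [r + E] := MVT_segment ts zD zc; rewrite in_itv /= => rs.
  have [|d [_ dE] cd] := zd r; first lra.
  have : - c * (s - t) <= dz r * (s - t) by rewrite ler_wpM2r /dz ?dE//; lra.
  lra.
(* Instead of a limit at [T], a later time [s] with [z s <= z t / 2] is chosen; absorbing this half
   costs the factor [2]. *)
have zhalf t : t1 <= t < T -> z t <= 2 * c * (T - t).
  move=> tT; have z0 : 0 < z t by apply: powR_gt0; have := lt1 t tT; lra.
  pose N := (2 / z t) `^ (a - 1)^-1.
  have N0 : 0 <= N by exact: powR_ge0.
  have zN0 : 0 < 2 / z t by rewrite divr_gt0.
  have [s [lN ls ts sT]] : exists s, [/\ N <= l s, 1 <= l s, t < s & s < T].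
    apply: (@filter_ex _ (T^'-)).
    near=> s; split.
    - by near: s; exact: linf.
    - by near: s; exact: linf.
    - by near: s; apply: nbhs_left_gt; lra.
    - by near: s; exact: nbhs_left_lt.
  have zs : z s <= z t / 2.
    have : 2 / z t <= l s `^ (a - 1).
      have <- : N `^ (a - 1) = 2 / z t.
        by rewrite /N -powRrM mulVf ?powRr1 ?ltW//; apply/eqP; lra.
      by apply: ge0_ler_powR; rewrite ?nnegrE//; lra.
    rewrite /(z s) (_ : 1 - a = - (a - 1)); last by ring.
    rewrite powRN => h; rewrite -[z t / 2]invrK invf_div lef_pV2 ?posrE//.
    by apply: powR_gt0; lra.
  have := zle t s ltac:(lra) (ltW ts) sT.
  have : c * (s - t) <= c * (T - t) by rewrite ler_wpM2l; lra.
  lra.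
near=> t.
have tT : t < T by near: t; exact: nbhs_left_lt.
have t1t : t1 <= t by near: t; exact: nbhs_left_ge.
(* Beyond this threshold [l ^ (2 - a)] is at least [2 * c]. *)
pose N := (2 * c) `^ (2 - a)^-1.
have lN : N <= l t by near: t; exact: linf.
have l1 : 1 <= l t by apply: lt1; lra.
rewrite -/(l t).
have c2 : 0 <= 2 * c by lra.
have : 2 * c <= l t `^ (2 - a).
  have <- : N `^ (2 - a) = 2 * c.
    by rewrite /N -powRrM mulVf ?powRr1//; apply/eqP; lra.
  by apply: ge0_ler_powR; rewrite ?nnegrE ?powR_ge0//; lra.
have <- : l t * z t = l t `^ (2 - a).
  rewrite -mulr_powRB1; [|lra|lra].
  by rewrite /z (_ : 2 - a - 1 = 1 - a)//; lra.
have : l t * z t <= l t * (2 * c * (T - t)).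
  by rewrite ler_wpM2l ?zhalf//; lra.
move=> P1 P2; have : 2 * c * 1 <= 2 * c * (l t * (T - t)) by lra.
by rewrite ler_pM2l//; lra.
Unshelve. all: by end_near. Qed.

End CenterRate.

(** * Exponential profiles under the heat operator *)

Section ExponentialProfiles.
Context {R : realType}.

Lemma heat_op_expR (A q dq : R -> R) (t x A' q2 M : R) :
  is_derive t (1 : R) A A' -> (forall y, is_derive y (1 : R) q (dq y)) ->
  is_derive x (1 : R) dq q2 ->
  heat_op (fun s y => expR (A s * q y) - M) t x
    ((A' * q x - A t * q2 - (A t * dq x) ^+ 2) * expR (A t * q x)).
Proof.
move=> DA Dq Ddq.
have Ex y : is_derive y (1 : R) (fun y => expR (A t * q y))
    (expR (A t * q y) * (A t * dq y)).
  have D : is_derive y (1 : R) (fun y => A t * q y) (A t * dq y) by exact: is_deriveZ.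
  exact: (@is_derive1_comp _ expR (fun y => A t * q y)).
have Et : is_derive t (1 : R) (fun s => expR (A s * q x)) (expR (A t * q x) * (q x * A')).
  have D : is_derive t (1 : R) (fun s => A s * q x) (q x * A').
    rewrite (_ : (fun s => A s * q x) = (fun s => q x * A s)); first exact: is_deriveZ.
    by apply/funext => s; rewrite mulrC.
  exact: (@is_derive1_comp _ expR (fun s => A s * q x)).
exists (expR (A t * q x) * (q x * A') - 0),
  (expR (A t * q x) * (A t * q2) + (A t * dq x) * (expR (A t * q x) * (A t * dq x))),
  (fun y => expR (A t * q y) * (A t * dq y)); split.
- exact: is_deriveB.
- apply: (@filterE _ (nbhs x)) => y.
  by rewrite -[X in is_derive _ _ _ X]subr0; exact: is_deriveB.
- have D2 : is_derive x (1 : R) (fun y => A t * dq y) (A t * q2) by exact: is_deriveZ.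
  exact: is_deriveM (Ex x) D2.
- by ring.
Qed.

Lemma within_continuous_expR (A q : R -> R) (M : R) (K : set (R * R)) :
  (forall z, K z -> {for z.1, continuous A}) -> continuous q ->
  {within K, continuous (fun z => expR (A z.1 * q z.2) - M)}.
Proof.
move=> cA cq; apply: continuous_in_subspaceT => z; rewrite inE => Kz.
apply: (@continuousB _ _ _ (fun z : R * R => expR (A z.1 * q z.2)) (fun=> M));
  last exact: cst_continuous.
apply: (@continuous_comp _ _ _ (fun z : R * R => A z.1 * q z.2) expR);
  last exact: continuous_expR.
apply: (@continuousM _ _ (fun z : R * R => A z.1) (fun z : R * R => q z.2)).
  by apply: (@continuous_comp _ _ _ fst A); [exact: cvg_fst|exact: cA].
by apply: (@continuous_comp _ _ _ snd q); [exact: cvg_snd|exact: cq].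
Qed.

Lemma is_derive_continuous (f : R -> R) (x d : R) :
  is_derive x (1 : R) f d -> {for x, continuous f}.
Proof. by case=> + _; move/derivable1_diffP/differentiable_continuous. Qed.

End ExponentialProfiles.

(** * Global blowup *)

Section GlobalBlowup.
Context {R : realType}.
Variables (a : R) (V u0 : R -> R) (T : R) (u : R -> R -> R).
Hypotheses (ha : 1 < a < 2) (usol : classical_solution a V u0 T%:E u).

Hypotheses (bV : profile V) (bu0 : profile u0) (u01 : u0 1 = 0).
Hypothesis blowup : sup (u t @` cI) @[t --> T^'-] --> +oo.

(** With [A = 1 / (T - t)] and [q = (1 - x) ^ 2] one has [A' = A ^ 2], and the factor of the
    exponential is [- 3 A ^ 2 q - 2 A <= 0], so only the sign of the source matters. At [x = 0] the
    center rate gives [exp A <= 1 + u]. The constant [M], the largest value of the exponential at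
    [t0], settles the initial time and, being at least [1], both ends. *)
Lemma global_lower_bound : exists t0 M, 0 < t0 < T /\
  forall t x, t0 <= t < T -> 0 <= x <= 1 ->
    expR ((T - t)^-1 * (1 - x) ^+ 2) - M <= u t x.
Proof.
have [a1 a2] := andP ha.
have T0 : 0 < T by have := sol_time_gt0 usol; rewrite lte_fin.
have [t0 /andP[t00 t0T] rate] : exists2 t0, 0 < t0 < T &
    forall t, t0 <= t < T -> 1 <= ln (1 + u t 0) * (T - t).
  have := center_rate ha usol bV bu0 u01 blowup.
  rewrite /at_left near_withinE => /nbhs_ballP[e /= e0 eP].
  pose m := Num.min e T.
  have m0 : 0 < m by rewrite lt_min e0.
  have me : m <= e by rewrite ge_min lexx.
  have mT : m <= T by rewrite ge_min lexx orbT.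
  exists (T - m / 2); first lra.
  move=> t tT; apply: eP; last by lra.
  by rewrite /ball /= gtr0_norm; lra.
pose M := expR (T - t0)^-1.
have M1 : 1 <= M by rewrite -expR0 ler_expR invr_ge0; lra.
exists t0, M; split; first by rewrite t00.
move=> t x tT x01.
(* Time is counted from [t0], because the comparison starts at time [0]. *)
pose A (s : R) := (T - (s + t0))^-1.
pose q (y : R) := (1 - y) ^+ 2.
pose v (s y : R) := expR (A s * q y) - M.
have sqr01 y : 0 <= y <= 1 -> 0 <= q y <= 1.
  by move=> y1; rewrite /q sqr_ge0 expr_le1//; lra.
have D1 z : is_derive z (1 : R) (fun y => 1 - y) (0 - 1) by exact: is_deriveB.
have Dq z : is_derive z (1 : R) q (- 2 * (1 - z)).
  apply: (is_derive_ext (is_deriveM (D1 z) (D1 z))) => [y|].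
    by rewrite /q expr2.
  by rewrite /GRing.scale /=; ring.
have DA s : s <= t - t0 -> is_derive s (1 : R) A (A s ^+ 2).
  move=> st; have D : is_derive s (1 : R) (fun s => T - (s + t0)) (0 - (1 + 0)).
    by apply: is_deriveB; apply: is_deriveD.
  have ne : T - (s + t0) != 0 by apply/eqP; lra.
  apply: (is_derive_ext (@is_deriveV _ (fun s => T - (s + t0)) s _ _ ne D)) => //.
  by rewrite /GRing.scale /= /A exprVn; ring.
suff : v (t - t0) x <= u ((t - t0) + t0) x by rewrite /v /A subrK.
have tt0 : 0 <= t - t0 by lra.
have tT' : ((t - t0 + t0)%:E < T%:E)%E by rewrite subrK lte_fin; lra.
apply: (@comparison R a (t - t0) 0 1 0 (fun _ _ => 0) (fun s y => u (s + t0) y) v) => //;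
  rewrite ?tt0 ?lexx //=.
- by refine (solution_shift_rectangle usol (ltW t00) tT' _ _); lra.
- apply: within_continuous_expR => [[s y] /= | y].
    by rewrite !in_itv /= => -[st _]; apply: is_derive_continuous (DA s _); lra.
  exact: is_derive_continuous (Dq y).
- by move=> s y st y1; apply: (solution_ge0 usol); rewrite ?lte_fin; lra.
- move=> s y st y1 _; split; first by [].
  have Ddq : is_derive y (1 : R) (fun z : R => - 2 * (1 - z)) 2.
    apply: (is_derive_ext (is_deriveZ (- 2) (D1 y))) => //.
    by rewrite /GRing.scale /=; ring.
  exists (V y * source a (u (s + t0) y)).
  exists ((A s ^+ 2 * q y - A s * 2 - (A s * (- 2 * (1 - y))) ^+ 2) * expR (A s * q y)).
  split.
  + by apply/heat_op_shift/(solution_heat_op usol); rewrite ?lte_fin; lra.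
  + by apply: heat_op_expR => //; apply: DA; lra.
  + rewrite mul0r mulr_ge0//; first by apply: (profile_ge0 bV); lra.
    by apply/source_ge0/(solution_ge0 usol); rewrite ?lte_fin; lra.
  + rewrite mul0r pmulr_lle0 ?expR_gt0//.
    have A0 : 0 <= A s by rewrite invr_ge0; lra.
    have : 0 <= A s ^+ 2 * q y by rewrite mulr_ge0// sqr_ge0.
    rewrite /q; lra.
- move=> y y1; rewrite add0r /v lerBlDr.
  apply: (@le_trans _ _ M).
    rewrite ler_expR /A add0r ler_piMr//; first by rewrite invr_ge0; lra.
    by have := sqr01 y y1; lra.
  by rewrite lerDr; apply: (solution_ge0 usol); rewrite ?lte_fin; lra.
- move=> s st; have sT : s + t0 < T by lra.
  have := rate (s + t0) ltac:(lra).
  have u0' : 0 <= u (s + t0) 0 by apply: (solution_ge0 usol); rewrite ?lte_fin; lra.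
  move=> le1; have Ale : A s <= ln (1 + u (s + t0) 0).
    by rewrite /A -[leLHS]mulr1 ler_pdivrMl; lra.
  have : expR (A s) <= 1 + u (s + t0) 0.
    by rewrite -[leRHS]lnK ?ler_expR// posrE; lra.
  by rewrite /v /q subr0 expr1n mulr1; lra.
- move=> s st; have sT : s + t0 < T by lra.
  have [_ ->] := solution_boundary usol (t := s + t0) ltac:(lra) ltac:(by rewrite lte_fin).
  by rewrite /v /q subrr expr0n mulr0 expR0; lra.
Qed.

Lemma global_blowup x : -1 < x < 1 -> u t x @[t --> T^'-] --> +oo.
Proof.
have [a1 a2] := andP ha.
have [t0 [M [/andP[t00 t0T] lb]]] := global_lower_bound.
have right (y : R) : 0 <= y < 1 -> forall B, \forall t \near T^'-, B <= u t y.
  move=> y1 B; pose d := (1 - y) ^+ 2.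
  have d0 : 0 < d by rewrite exprn_gt0//; lra.
  have BM : 0 < `|B| + `|M| + 1 by have := normr_ge0 B; have := normr_ge0 M; lra.
  have e0 : 0 < d / (`|B| + `|M| + 1) by rewrite divr_gt0.
  near=> t.
  have t0t : t0 <= t by near: t; exact: nbhs_left_ge.
  have tT : t < T by near: t; exact: nbhs_left_lt.
  have te : T - d / (`|B| + `|M| + 1) < t by near: t; apply: nbhs_left_gt; lra.
  have := lb t y ltac:(lra) ltac:(lra); apply: le_trans.
  have : `|B| + `|M| + 1 <= (T - t)^-1 * d.
    rewrite ler_pdivlMl; last by lra.
    by rewrite -ler_pdivlMr//; lra.
  have := expR_ge1Dx ((T - t)^-1 * (1 - y) ^+ 2); rewrite -/d.
  have := ler_norm B; have := ler_norm M; lra.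
move=> x1; apply/cvgryPge => B; have [x0|x0] := leP 0 x; first by apply: right; lra.
have := right (- x) ltac:(lra) B => rB; near=> t.
rewrite -(solution_even a1 usol bV bu0 u01); [by near: t| | |lra].
  by apply: ltW; apply: lt_trans t00 _; near: t; exact: nbhs_left_gt.
by rewrite lte_fin; near: t; exact: nbhs_left_lt.
Unshelve. all: by end_near. Qed.

End GlobalBlowup.

(** * Finite existence time for large data *)

Section FiniteExistenceTime.
Context {R : realType}.

(** Here [r] stands for [x ^ 2 / delta ^ 2], [m] for [1 / delta ^ 2] and [E] for [A ^ (a - 1)]. For
    [r >= 1 / 2] the gradient term has size at least [2 m A ^ 2] and beats the two others, as
    [E <= A] and [2 <= A]. For [r < 1 / 2] it is dropped: the logarithm is at least [A / 2], the
    source at least [c kappa A E / 2] times the exponential, and the conditions on [eps] and [E]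
    give each remaining term at most half of that. *)
Lemma blowup_inequality (a c m eps A E r : R) :
  1 < a -> 0 < c -> 0 < m -> eps <= m -> eps <= c * (1 / 2) `^ a / 4 ->
  0 <= eps -> 2 <= E -> 8 * m <= c * (1 / 2) `^ a * E -> E <= A ->
  0 <= r <= 1 -> A `^ a = A * E ->
  (eps * (A * E) * (1 - r) - A * (0 - m * (2 * 1)) - 4 * m * (A ^+ 2 * r)) *
    expR (A * (1 - r)) <= c * source a (expR (A * (1 - r)) - 1).
Proof.
move=> a1 c0 m0 epsm; set kappa := _ `^ a => epsc eps0 E2 big EA r01 Aa.
have kappa0 : 0 < kappa by apply: powR_gt0; lra.
have AE0 : 0 <= A * E by rewrite mulr_ge0//; lra.
have w0 := expR_gt0 (A * (1 - r)).
have W1 : 1 <= expR (A * (1 - r)).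
  by rewrite -[leLHS]expR0 ler_expR mulr_ge0//; lra.
have r2 : 0 <= m * (A ^+ 2 * r) by rewrite !mulr_ge0 ?sqr_ge0//; lra.
have eps1 : eps * (A * E) * (1 - r) <= eps * (A * E).
  by rewrite ler_piMr ?mulr_ge0//; lra.
have [rbig|rsmall] := leP (1 / 2) r.
  apply: (@le_trans _ _ 0); last by rewrite mulr_ge0 ?source_ge0 ?subr_ge0// ltW.
  rewrite pmulr_lle0//.
  have A2 : m * (2 * A) <= m * A ^+ 2 by rewrite ler_pM2l// expr2 ler_wpM2r//; lra.
  have AE : m * (A * E) <= m * A ^+ 2 by rewrite ler_pM2l// expr2 ler_wpM2l//; lra.
  have : eps * (A * E) <= m * (A * E) by rewrite ler_wpM2r.
  have : m * (A ^+ 2 * (1 / 2)) <= m * (A ^+ 2 * r).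
    by rewrite ler_pM2l// ler_wpM2l ?sqr_ge0.
  lra.
have Aq1 : 1 / 2 * A <= A * (1 - r) by rewrite mulrC ler_wpM2l//; lra.
have w2 : 2 <= expR (A * (1 - r)) by have := expR_ge1Dx (A * (1 - r)); lra.
have src : kappa * (A * E) <= (A * (1 - r)) `^ a.
  rewrite -Aa /kappa -powRM; [|lra|lra].
  by apply: ge0_ler_powR; rewrite ?nnegrE; lra.
rewrite /source (_ : 1 + (expR (A * (1 - r)) - 1) = expR (A * (1 - r))); last by ring.
rewrite expRK.
have big' : 8 * m * A <= c * kappa * E * A by rewrite ler_wpM2r//; lra.
have ee : eps * (A * E) <= c * kappa / 4 * (A * E) by rewrite ler_wpM2r.
apply: (@le_trans _ _ (c * kappa / 2 * (A * E) * expR (A * (1 - r)))).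
  by rewrite ler_pM2r//; lra.
apply: (@le_trans _ _ (c * (expR (A * (1 - r)) / 2 * (kappa * (A * E))))); first lra.
have kAE0 : 0 <= kappa * (A * E) by rewrite mulr_ge0// ltW.
by rewrite ler_pM2l// ler_pM//; lra.
Qed.

(* [A = E ^ p] with [p = 1 / (a - 1)] and [1 / E] affine. *)
Lemma blowing_up_ode (a eps E0 : R) : 1 < a < 2 -> 0 < eps -> 1 <= E0 ->
  exists (tstar : R) (A : R -> R), forall M : R, exists tau : R,
    [/\ 0 < tau <= tstar, M <= A tau, A 0 = E0 `^ (a - 1)^-1 &
      forall s, 0 <= s <= tau -> exists E : R,
        [/\ is_derive s (1 : R) A (eps * (A s * E)), E0 <= E, E <= A s &
          A s `^ a = A s * E]].
Proof.
move=> /andP[a1 a2] eps0 E01.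
pose p := (a - 1)^-1.
(* The bound [a < 2] enters here: it yields [E <= E ^ p = A]. *)
have p1 : 1 <= p by rewrite -invr1 /p lef_pV2 ?posrE; lra.
have p0 : 0 < p by lra.
have pa : (a - 1) * p = 1 by rewrite /p mulfV//; apply/eqP; lra.
(* With [E' = sigma E ^ 2] this gives [A' = p sigma E ^ (p + 1) = eps A E]. *)
have [sigma [sigma0 sigmap]] : exists sigma, 0 < sigma /\ p * sigma = eps.
  by exists (eps / p); rewrite divr_gt0// mulrC divfK// gt_eqF.
have E00 : 0 < E0 by lra.
pose E (s : R) := (E0^-1 - sigma * s)^-1.
pose A (s : R) := E s `^ p.
have DA s : 0 < E0^-1 - sigma * s -> is_derive s (1 : R) A (eps * (A s * E s)).
  move=> s0; have Es0 : 0 < E s by rewrite invr_gt0.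
  have D1 : is_derive s (1 : R) (fun r => E0^-1 - sigma * r) (0 - sigma * 1).
    by apply: is_deriveB; apply: is_deriveZ.
  have ne : E0^-1 - sigma * s != 0 by rewrite gt_eqF.
  have D2 : is_derive s (1 : R) E (sigma * E s ^+ 2).
    apply: (is_derive_ext (@is_deriveV _ (fun r => E0^-1 - sigma * r) s _ _ ne D1)) => //.
    by rewrite /GRing.scale /= /E exprVn; ring.
  have D3 : is_derive s (1 : R) A (p * E s `^ (p - 1) * (sigma * E s ^+ 2)).
    by apply: (@is_derive1_comp _ (@powR R ^~ p) E); exact: is_derive1_powR.
  apply: (is_derive_ext D3) => //.
  by rewrite -sigmap /A -(@mulr_powRB1 _ (E s) p (ltW Es0) p0); ring.
(* This is the zero of [1 / E]. It does not depend on [M], so a bound for a global solution up to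
   this time can serve as [M]. *)
exists (E0^-1 / sigma), A => M.
(* [eta] is the value of [1 / E] at [tau], whence [A tau >= E tau = 1 / eta >= M]. *)
have [eta eta0 [etaE etaM]] : exists2 eta : R, 0 < eta & eta < E0^-1 /\ M <= eta^-1.
  have MM := ler_norm M; have M0 := normr_ge0 M.
  exists (E0 + `|M| + 1)^-1; first by rewrite invr_gt0; lra.
  by rewrite invrK ltf_pV2 ?posrE; lra.
pose tau := (E0^-1 - eta) / sigma.
have tau0 : 0 < tau by rewrite divr_gt0//; lra.
have tausigma : sigma * tau = E0^-1 - eta by rewrite mulrC divfK// gt_eqF.
have Dpos s : 0 <= s <= tau -> eta <= E0^-1 - sigma * s <= E0^-1.
  move=> st; have : sigma * s <= sigma * tau by rewrite ler_pM2l//; lra.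
  have : 0 <= sigma * s by rewrite mulr_ge0//; lra.
  lra.
have EE0 s : 0 <= s <= tau -> E0 <= E s.
  move=> /Dpos st; rewrite -[E0]invrK /E lef_pV2 ?posrE ?invr_gt0//; lra.
have EA s : 0 <= s <= tau -> E s <= A s.
  by move=> /EE0 st; apply: le1r_powR => //; lra.
exists tau; split.
- by rewrite tau0 /= ler_pM2r ?invr_gt0//; lra.
- apply: le_trans (EA _ _); last by rewrite lexx ltW.
  by rewrite /E tausigma opprB addrCA subrr addr0.
- by rewrite /A /E mulr0 subr0 invrK.
move=> s st; exists (E s); split.
- by apply: DA; have := Dpos s st; lra.
- exact: EE0.
- exact: EA.
have := EE0 s st => Es0.
rewrite /A -powRrM (_ : p * a = p + 1); last by lra.
rewrite powRD; last by apply/implyP => _; rewrite gt_eqF//; lra.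
by rewrite powRr1//; lra.
Qed.

(* With [v = log (1 + w)] the source contributes [v ^ a] up to a constant and
   the diffusion gains [(v_x) ^ 2]; hence [v = A(t) * (1 - x^2 / delta^2)] is a
   subsolution as soon as [A' = eps * A ^ a], which blows up. *)
Lemma finite_existence_time (a delta c : R) (V phi : R -> R) :
  1 < a < 2 -> 0 < delta < 1 -> 0 < c ->
  (forall x, - delta <= x <= delta -> c <= V x) ->
  (forall x, - delta <= x <= delta -> c <= phi x) ->
  exists2 L : R, 0 < L & forall lam, L <= lam ->
    forall (T : \bar R) (u : R -> R -> R),
      classical_solution a V (fun x => lam * phi x) T u -> (T < +oo)%E.
Proof.
move=> ha /andP[delta0 delta1] c0 Vc phic; have [a1 a2] := andP ha.
have [kappa kappa0 kappaE] : exists2 kappa : R, 0 < kappa & kappa = (1 / 2) `^ a.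
  by exists ((1 / 2) `^ a) => //; apply: powR_gt0; lra.
have [m m0 mdelta] : exists2 m : R, 0 < m & m * delta ^+ 2 = 1.
  exists (delta ^+ 2)^-1; first by rewrite invr_gt0 exprn_gt0.
  by rewrite mulVf// gt_eqF// exprn_gt0.
have ck0 : 0 < c * kappa by rewrite mulr_gt0.
(* [E0] and [eps] meet the conditions of [blowup_inequality]; those on [E] persist because [E] stays
   above [E0]. *)
have [E0 [E02 E0m]] : exists E0, 2 <= E0 /\ 8 * m <= c * kappa * E0.
  have K0 : 0 < 8 * m / (c * kappa) by rewrite divr_gt0//; lra.
  exists (2 + 8 * m / (c * kappa)); split; first lra.
  by rewrite [leRHS]mulrC -ler_pdivrMr//; lra.
have [eps eps0 [epsm epsc]] : exists2 eps : R, 0 < eps & eps <= m /\ eps <= c * kappa / 4.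
  exists (Num.min m (c * kappa / 4)); first by rewrite lt_min m0 /=; lra.
  by rewrite !ge_min !lexx orbT.
have [|tstar [A AP]] := @blowing_up_ode a eps E0 ha eps0; first lra.
pose A0 := E0 `^ (a - 1)^-1.
(* Beyond this value [lam * phi >= lam * c >= exp A0] on [[-delta, delta]], which lies above the
   subsolution at time [0]. *)
exists (expR A0 / c); first by rewrite divr_gt0// expR_gt0.
move=> lam lamL T u usol; have [//|Tinf] := ltP T +oo%E.
have sT (s : R) : (s%:E < T)%E by apply: lt_le_trans Tinf; exact: ltry.
have [M M0 uM] := rectangle_bounded
  (solution_rectangle usol (sT tstar) (lexx _) (lexx _)).
(* Since [exp A - 1 >= A], the subsolution at [tau] exceeds at the center the bound [M] on [u]. *)
have [tau [/andP[tau0 taut] AM Ainit Aode]] := AP (M + 1).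
pose q (y : R) := 1 - m * y ^+ 2.
pose v (s y : R) := expR (A s * q y) - 1.
have uge0 s y : 0 <= s -> - delta <= y <= delta -> 0 <= u s y.
  by move=> s0 y1; apply: (solution_ge0 usol) => //; lra.
have Dsq z : is_derive z (1 : R) (fun y : R => y ^+ 2) (2 * z).
  apply: (is_derive_ext (is_deriveM (is_derive_id z (1 : R)) (is_derive_id z (1 : R)))) => [y|].
    by rewrite expr2.
  by rewrite /GRing.scale /=; ring.
have Dq z : is_derive z (1 : R) q (0 - m * (2 * z)).
  by apply: is_deriveB; apply: is_deriveZ.
have Ddq z : is_derive z (1 : R) (fun z : R => 0 - m * (2 * z)) (0 - m * (2 * 1)).
  by apply: is_deriveB; apply: is_deriveZ; apply: is_deriveZ.
have sq01 y : - delta <= y <= delta -> 0 <= m * y ^+ 2 <= 1.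
  move=> y1; have yd : y ^+ 2 <= delta ^+ 2.
    rewrite -[y ^+ 2]real_normK ?num_real// ler_sqr ?nnegrE; [|exact: normr_ge0|exact: ltW].
    by rewrite ler_norml.
  have := ler_wpM2l (ltW m0) yd; rewrite mdelta => ->.
  by rewrite mulr_ge0 ?sqr_ge0// ltW.
have tau_ge0 := ltW tau0; have c_ge0 := ltW c0.
have dd : - delta <= delta by lra.
have d01 : - delta <= 0 <= delta by lra.
have tautau : 0 <= tau <= tau by rewrite tau_ge0 lexx.
have sub : v tau 0 <= u tau 0.
  apply: (@comparison R a tau (- delta) delta c (fun _ _ => c) u v) => //.
  - by refine (solution_rectangle usol (sT tau) _ _); lra.
  - apply: within_continuous_expR => [[s y] /= | y].
      rewrite !in_itv /= => -[st _]; have [E [DA _ _ _]] := Aode s st.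
      exact: is_derive_continuous DA.
    exact: is_derive_continuous (Dq y).
  - by move=> s y /andP[s0 _] y1; exact: uge0.
  - move=> s y st y1 _; split; first by apply/andP; split => //; exact: ltW.
    have s0 : 0 <= s by case/andP: st => /ltW.
    have yd : - delta <= y <= delta by case/andP: y1 => /ltW -> /ltW.
    have [|E [DA EE0 EA Aa]] := Aode s; first by case/andP: st => _ ->; rewrite s0.
    exists (V y * source a (u s y)).
    exists ((eps * (A s * E) * q y - A s * (0 - m * (2 * 1)) -
      (A s * (0 - m * (2 * y))) ^+ 2) * expR (A s * q y)); split.
    + by apply: (solution_heat_op usol) => //; [|move: y1 delta1; clear]; lra.
    + exact: (heat_op_expR _ DA Dq (Ddq y)).
    + by apply: ler_wpM2r; [exact/source_ge0/uge0|exact: Vc].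
    + have -> : (A s * (0 - m * (2 * y))) ^+ 2 = 4 * m * (A s ^+ 2 * (m * y ^+ 2)) by ring.
      apply: (@blowup_inequality a c m eps (A s) E) => //; rewrite -?kappaE//.
      * exact: ltW.
      * exact: le_trans EE0.
      * by apply: le_trans E0m _; rewrite ler_pM2l.
      * exact: sq01.
  - move=> y y1; rewrite (sol_initial usol); last lra.
    have sq := sq01 y y1.
    have wA : expR (A 0 * q y) <= expR A0.
      by rewrite ler_expR Ainit ler_piMr ?powR_ge0// /q; lra.
    have lamc : expR A0 <= lam * c by rewrite -ler_pdivrMr.
    have lam0 : 0 <= lam by apply: le_trans lamL; rewrite divr_ge0// ?expR_ge0// ltW.
    have : lam * c <= lam * phi y by rewrite ler_wpM2l ?phic.
    by rewrite /v; lra.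
  - move=> s st; rewrite /v /q sqrrN mdelta subrr mulr0 expR0 subrr.
    by case/andP: st => s0 _; apply: uge0 => //; rewrite ?lexx ?dd.
  - move=> s st; rewrite /v /q mdelta subrr mulr0 expR0 subrr.
    by case/andP: st => s0 _; apply: uge0 => //; rewrite ?lexx ?dd.
exfalso; have uM' := le_trans (ler_norm _) (uM tau 0 ltac:(lra) ltac:(lra)).
have := expR_ge1Dx (A tau).
move: sub; rewrite /v /q expr0n mulr0 subr0 mulr1.
lra.
Qed.

End FiniteExistenceTime.

(** * Monotonicity in time *)

Section MonotoneInTime.
Context {R : realType}.
Variables (a : R) (V u0 : R -> R) (T : \bar R) (u : R -> R -> R).
Hypotheses (a1 : 1 < a) (usol : classical_solution a V u0 T u).
Hypotheses (bV : profile V) (bu0 : profile u0) (u01 : u0 1 = 0).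
Hypothesis u0_sub : forall t x, -1 < x < 1 -> exists h,
  heat_op (fun=> u0) t x h /\ h <= V x * source a (u0 x).

Lemma solution_ge_initial (t x : R) : 0 <= t -> (t%:E < T)%E -> -1 <= x <= 1 ->
  u 0 x <= u t x.
Proof.
move=> t0 tT x1.
have V00 : 0 <= V 0 by apply: (profile_ge0 bV); lra.
have sT (s : R) : s <= t -> (s%:E < T)%E.
  by move=> st; apply: le_lt_trans tT; rewrite lee_fin.
have uc := solution_rectangle usol tT (lexx _) (lexx _).
(* [u 0] is compared instead of [u0] because its continuity on the closed rectangle comes with that
   of [u]. *)
apply: (@comparison R a t (-1) 1 (V 0) (fun _ => V) u (fun _ y => u 0 y)) => //;
  rewrite ?t0 ?lexx //.
- apply: (@continuous_within_comp _ _ _ _ (`[0, t] `*` `[(-1 : R), 1]) _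
    (fun z : R * R => (0 : R, z.2)) uc).
    by apply/continuous_subspaceT/continuous_pair => z; [exact: cvg_cst|exact: cvg_snd].
  by move=> [s y] /=; rewrite !in_itv /= lexx t0 => -[].
- by move=> s y st y1; apply: (solution_ge0 usol) => //; [lra|apply: sT; lra].
- move=> s y st y1 _; split.
    by apply/andP; split; [apply: (profile_ge0 bV)|apply: (profile_le_center bV)]; lra.
  have [h [H hle]] := u0_sub s y1.
  have E0 z : -1 < z < 1 -> u0 z = u 0 z.
    by move=> z1; rewrite (solution_initial usol bu0 u01)//; lra.
  exists (V y * source a (u s y)), h; split=> //.
  + by apply: (solution_heat_op usol) => //; [lra|apply: sT; lra].
  + apply: heat_op_near H; first by apply: (@filterE _ (nbhs s)) => r; exact: E0.
    have : \forall z \near y, z \in `](-1), 1[ by apply: near_in_itvoo; rewrite in_itv.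
    by apply: filterS => z; rewrite in_itv /= => z1; exact: E0.
  + by rewrite -E0.
- move=> s st; have [-> _] := solution_boundary usol (t := 0) ltac:(lra) (sol_time_gt0 usol).
  by apply: (solution_ge0 usol) => //; [lra|apply: sT; lra|lra].
- move=> s st; have [_ ->] := solution_boundary usol (t := 0) ltac:(lra) (sol_time_gt0 usol).
  by apply: (solution_ge0 usol) => //; [lra|apply: sT; lra|lra].
Qed.

(** The coefficients do not depend on time, so a translate again solves the equation, and it starts
    above [u 0]. *)
Lemma solution_shift_ge (t h x : R) : 0 <= t -> 0 <= h -> ((t + h)%:E < T)%E ->
  -1 <= x <= 1 -> u t x <= u (t + h) x.
Proof.
move=> t0 h0 thT x1.
have V00 : 0 <= V 0 by apply: (profile_ge0 bV); lra.
have sT (s : R) : s <= t + h -> (s%:E < T)%E.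
  by move=> st; apply: le_lt_trans thT; rewrite lee_fin.
apply: (@comparison R a t (-1) 1 (V 0) (fun _ => V) (fun s y => u (s + h) y) u) => //;
  rewrite ?t0 ?lexx //.
- by refine (solution_shift_rectangle usol h0 thT _ _).
- by refine (solution_rectangle usol (sT t _) _ _) => //; lra.
- by move=> s y st y1; apply: (solution_ge0 usol) => //; [lra|apply: sT; lra].
- move=> s y st y1 _; split.
    by apply/andP; split; [apply: (profile_ge0 bV)|apply: (profile_le_center bV)]; lra.
  exists (V y * source a (u (s + h) y)), (V y * source a (u s y)); split=> //.
  + by apply/heat_op_shift/(solution_heat_op usol) => //; [lra|apply: sT; lra].
  + by apply: (solution_heat_op usol) => //; [lra|apply: sT; lra].
- by move=> y y1; rewrite add0r; apply: solution_ge_initial => //; apply: sT; lra.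
- move=> s st; have [-> _] := solution_boundary usol (t := s) ltac:(lra) (sT s ltac:(lra)).
  by apply: (solution_ge0 usol) => //; [lra|apply: sT; lra|lra].
- move=> s st; have [_ ->] := solution_boundary usol (t := s) ltac:(lra) (sT s ltac:(lra)).
  by apply: (solution_ge0 usol) => //; [lra|apply: sT; lra|lra].
Qed.

Lemma u_t_ge0 (t x : R) : 0 < t -> (t%:E < T)%E -> -1 <= x <= 1 -> 0 <= u_t u t x.
Proof.
move=> t0 tT x1.
have cyl : open_cylinder T (t, x) by split => //; split => //=; rewrite /cI /= in_itv.
have D : is_derive t (1 : R) (fun s => u s x) (u_t u t x).
  rewrite /u_t derive1E; apply: derivableP.
  by refine (sol_derivable_t usol cyl).
have [e e0 eT] : exists2 e : R, 0 < e & ((t + e)%:E < T)%E.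
  case: T tT => [r|_|//]; last by exists 1; rewrite ?ltry.
  by rewrite lte_fin => tr; exists ((r - t) / 2); rewrite ?lte_fin; lra.
apply: (right_min_derive_ge0 D e0) => s ts.
rewrite -[s](addrNK t) addrC; apply: solution_shift_ge => //; [exact: ltW|lra|].
by apply: le_lt_trans eT; rewrite lee_fin; lra.
Qed.

End MonotoneInTime.

(** * Large multiples of the initial profile *)

Section LargeSubsolution.
Context {R : realType}.

Lemma C2_on_heat_op (phi : R -> R) (lam t x : R) : C2_on cI phi -> -1 < x < 1 ->
  heat_op (fun _ y => lam * phi y) t x
    (0 - lam * derive_on cI (derive_on cI phi) x).
Proof.
move=> [[phid _] [phidd _]] x1.
have cIP (y : R) : -1 < y < 1 -> cI y by move=> y1; rewrite /cI /= in_itv /=; lra.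
exists 0, (lam * derive_on cI (derive_on cI phi) x), (fun y => lam * derive_on cI phi y).
split; last by [].
- exact: is_derive_cst.
- have : \forall y \near x, y \in `](-1), 1[ by apply: near_in_itvoo; rewrite in_itv.
  apply: filterS => y; rewrite in_itv /= => y1; apply: is_deriveZ.
  by apply: derive_on_interior; [exact: nbhs_cI|exact/phid/cIP].
- apply: is_deriveZ.
  by apply: derive_on_interior; [exact: nbhs_cI|exact/phidd/cIP].
Qed.

(** On [[r, 1]] convexity makes [h] nonpositive. On [[0, r]] both sides are of order [lam] except
    for the factor [log (1 + lam phi) ^ a], which tends to infinity uniformly because [phi] has a
    positive minimum there, as does [V]. *)
Lemma large_multiple_subsolution (a r : R) (V phi : R -> R) : 1 < a ->
  0 < r < 1 -> profile V -> profile phi -> C1_on cI V -> C2_on cI phi ->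
  (forall x, 0 <= x <= r -> 0 < phi x /\ 0 < V x) ->
  (forall x, r <= x <= 1 -> 0 <= derive_on cI (derive_on cI phi) x) ->
  exists2 L : R, 0 < L & forall lam, L <= lam -> forall t x, -1 < x < 1 ->
    exists h, heat_op (fun _ y => lam * phi y) t x h /\
      h <= V x * source a (lam * phi x).
Proof.
move=> a1 r01 bV bphi [Vd _] phiC2 pos conv.
have [[phid _] [phidd phi2c]] := phiC2.
set phi2 := derive_on cI (derive_on cI phi) in conv phi2c *.
have cont g : (forall x, cI x -> derivable_on cI g x) -> {within `[0, r], continuous g}.
  move=> gd; apply: derivable_within_continuous => x; rewrite in_itv /= => x0r.
  have [] // : is_derive x (1 : R) g (derive_on cI g x).
  apply: derive_on_interior; first by apply: nbhs_cI; lra.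
  by apply: gd; rewrite /cI /= in_itv /=; lra.
have r0 : 0 <= r by lra.
have [xp + phimin] := EVT_min r0 (cont _ phid); rewrite in_itv /= => xp0.
have [xv + Vmin] := EVT_min r0 (cont _ Vd); rewrite in_itv /= => xv0.
have [phip _] := pos xp xp0; have [_ Vp] := pos xv xv0.
have [xm _ phi2min] := @EVT_min R phi2 (-1) 1 ltac:(lra) phi2c.
pose M := `|phi2 xm|.
have M0 : 0 <= M by exact: normr_ge0.
have phi2M y : -1 <= y <= 1 -> - M <= phi2 y.
  move=> y1; apply: le_trans (phi2min y _); last by rewrite in_itv.
  by rewrite lerNl /M -normrN ler_norm.
have vp0 : 0 < V xv * phi xp by rewrite mulr_gt0.
(* Chosen so that [V xv * phi xp * N >= M]; since [N >= 1], a logarithm above [N] has its power [a]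
   above [N] too. *)
pose N := 1 + M / (V xv * phi xp).
have N1 : 1 <= N by rewrite lerDl divr_ge0// ltW.
exists (expR N / phi xp); first by rewrite divr_gt0// expR_gt0.
move=> lam lamL t.
have lam0 : 0 < lam by apply: lt_le_trans lamL; rewrite divr_gt0// expR_gt0.
have right y : 0 <= y < 1 -> 0 - lam * phi2 y <= V y * source a (lam * phi y).
  move=> y01; have phiy0 : 0 <= phi y by apply: (profile_ge0 bphi); lra.
  have Vy0 : 0 <= V y by apply: (profile_ge0 bV); lra.
  have [yr|yr] := leP r y.
    apply: (@le_trans _ _ 0).
      by rewrite sub0r oppr_le0 mulr_ge0 ?conv//; lra.
    by rewrite mulr_ge0// source_ge0// mulr_ge0// ltW.
  have yr' : y \in `[0, r] by rewrite in_itv /=; lra.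
  have phixy := phimin y yr'; have Vxy := Vmin y yr'.
  have eN : expR N <= lam * phi y.
    apply: (@le_trans _ _ (lam * phi xp)); first by rewrite -ler_pdivrMr.
    by rewrite ler_pM2l.
  have lnN : N <= ln (1 + lam * phi y) `^ a.
    have Nln : N <= ln (1 + lam * phi y).
      have := expR_gt0 N => eN0.
      by rewrite -[N](@expRK R) ler_ln ?posrE//; lra.
    apply: (le_trans Nln); apply: le1r_powR; last exact: ltW.
    exact: le_trans Nln.
  have MN : M <= V xv * phi xp * N.
    by rewrite /N mulrDr mulr1 [X in _ + X]mulrC divfK ?gt_eqF// lerDr ltW.
  have S1 : lam * (- phi2 y) <= lam * M.
    by rewrite ler_pM2l// lerNl; apply: phi2M; lra.
  have S2 : lam * M <= lam * (V xv * phi xp * N) by rewrite ler_pM2l.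
  have S3 : V xv * phi xp * N <= V y * phi y * ln (1 + lam * phi y) `^ a.
    apply: ler_pM => //; [exact: ltW|lra|].
    by apply: ler_pM => //; exact: ltW.
  have S4 : lam * (V xv * phi xp * N) <= lam * (V y * phi y * ln (1 + lam * phi y) `^ a).
    by rewrite ler_pM2l.
  by rewrite /source; lra.
move=> x x1; have [x0|x0] := leP 0 x.
  by exists (0 - lam * phi2 x); split; [exact: C2_on_heat_op|apply: right; lra].
(* Negative [x]: the inequality at [- x] is carried over by reflection and evenness. *)
exists (0 - lam * phi2 (0 - x)); split; last first.
  have <- : V (0 - x) = V x by rewrite sub0r (profile_even bV)//; lra.
  have <- : phi (0 - x) = phi x by rewrite sub0r (profile_even bphi)//; lra.
  by apply: right; lra.
have H : heat_op (fun _ y => lam * phi (0 - y)) t x (0 - lam * phi2 (0 - x)).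
  by apply: (@heat_op_reflect _ (fun _ y => lam * phi y)); apply: C2_on_heat_op => //; lra.
have E z : -1 < z < 1 -> lam * phi (0 - z) = lam * phi z.
  by move=> z1; rewrite sub0r (profile_even bphi)//; lra.
apply: heat_op_near H; first by apply: (@filterE _ (nbhs t)) => s; exact: E.
have : \forall y \near x, y \in `](-1), 1[ by apply: near_in_itvoo; rewrite in_itv.
by apply: filterS => y; rewrite in_itv /= => y1; exact: E.
Qed.

End LargeSubsolution.

(** * From the stated hypotheses to profiles, and conclusion *)

Lemma profile_scale (R : realType) (lam : R) (phi : R -> R) : 0 <= lam ->
  profile phi -> profile (fun x => lam * phi x).
Proof.
move=> lam0 bphi; split=> [x x1|x x1|x y x0 xy y3|x x3].
- by rewrite mulr_ge0// (profile_ge0 bphi).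
- by rewrite (profile_even bphi).
- by rewrite ler_wpM2l// (profile_antitone bphi).
- by rewrite ler_wpM2l// (profile_tail bphi).
Qed.

Lemma C1_on_profile (R : realType) (g : R -> R) : C1_on cI g ->
  (forall x, cI x -> 0 <= g x) -> (forall x, cI x -> g (- x) = g x) ->
  (forall x : R, 0 <= x <= 1 / 3 -> derive_on cI g x <= 0) ->
  (forall x : R, 1 / 3 <= x <= 1 -> 0 <= g x <= g (1 / 3)) -> profile g.
Proof.
move=> g1 g0 ge g' gt; split.
- by move=> x x1; apply: g0; rewrite /cI /= in_itv.
- by move=> x x1; apply: ge; rewrite /cI /= in_itv.
- exact: C1_on_antitone.
- by move=> x /gt /andP[].
Qed.

Lemma C1_on_near0_ge (R : realType) (g : R -> R) : C1_on cI g -> 0 < g 0 ->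
  exists2 d : R, 0 < d & forall x, - d < x < d -> g 0 / 2 < g x.
Proof.
move=> [gd _] g0.
have D : is_derive (0 : R) (1 : R) g (derive_on cI g 0).
  by apply: derive_on_interior; [apply: nbhs_cI|apply: gd; rewrite /cI /= in_itv /=]; lra.
have gc : g x @[x --> (0 : R)] --> g 0 by exact: is_derive_continuous D.
have : \forall x \near (0 : R), g 0 / 2 < g x.
  by apply: (cvgr_gt _ gc); lra.
move=> /nbhs_ballP[e /= e0 eP]; exists e => // x xe; apply: eP.
by rewrite /ball /= sub0r normrN ltr_norml.
Qed.

Theorem proposition5p1 (R : realType) (a : R) (V phi : R -> R)
    (ha : 1 < a < 2)
    (V_C1 : C1_on cI V) (phi_C1 : C1_on cI phi)
    (V_ge0 : forall x, cI x -> 0 <= V x)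
    (phi_ge0 : forall x, cI x -> 0 <= phi x)
    (V0_gt0 : 0 < V 0) (phi0_gt0 : 0 < phi 0) (phi1 : phi 1 = 0)
    (V_even : forall x, cI x -> V (- x) = V x)
    (phi_even : forall x, cI x -> phi (- x) = phi x)
    (V'_le0 : forall x : R, 0 <= x <= 1 / 3 -> derive_on cI V x <= 0)
    (phi'_le0 : forall x : R, 0 <= x <= 1 / 3 -> derive_on cI phi x <= 0)
    (V_tail : forall x : R, 1 / 3 <= x <= 1 -> 0 <= V x <= V (1 / 3))
    (phi_tail : forall x : R, 1 / 3 <= x <= 1 -> 0 <= phi x <= phi (1 / 3)) :
  (* (i) *)
  ((exists2 L : R, 0 < L & forall lam : R, L <= lam ->
      forall (T : \bar R) (u : R -> R -> R),
        maximal_solution a V (fun x => lam * phi x) T u -> (T < +oo)%E) /\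
   (forall lam : R, 0 < lam ->
      forall (T : \bar R) (u : R -> R -> R),
        maximal_solution a V (fun x => lam * phi x) T u -> (T < +oo)%E ->
        forall x : R, -1 < x < 1 -> u t x @[t --> (fine T)^'-] --> +oo)) /\
  (* (ii) *)
  (C2_on cI phi ->
   forall r : R, 0 < r < 1 ->
   (forall x : R, 0 <= x <= r -> 0 < phi x /\ 0 < V x) ->
   (forall x : R, r <= x <= 1 -> 0 <= derive_on cI (derive_on cI phi) x) ->
   exists2 L : R, 0 < L & forall lam : R, L <= lam ->
     forall (T : \bar R) (u : R -> R -> R),
       maximal_solution a V (fun x => lam * phi x) T u ->
       forall t x : R, 0 < t -> (t%:E < T)%E -> -1 <= x <= 1 ->
         0 <= u_t u t x).
Proof.
have [a1 a2] := andP ha.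
have bV := C1_on_profile V_C1 V_ge0 V_even V'_le0 V_tail.
have bphi := C1_on_profile phi_C1 phi_ge0 phi_even phi'_le0 phi_tail.
split; first split.
- have [d1 d10 dV] := C1_on_near0_ge V_C1 V0_gt0.
  have [d2 d20 dphi] := C1_on_near0_ge phi_C1 phi0_gt0.
  (* Halved below, so that the closed interval [[-d/2, d/2]] lies inside the open ones and
     [d / 2 < 1]. *)
  pose d := Num.min 1 (Num.min d1 d2).
  have d0 : 0 < d by rewrite !lt_min ltr01 d10.
  have dle1 : d <= 1 by rewrite ge_min lexx.
  have dled1 : d <= d1 by rewrite !ge_min lexx orbT.
  have dled2 : d <= d2 by rewrite !ge_min lexx !orbT.
  pose c := Num.min (V 0) (phi 0) / 2.
  have c0 : 0 < c by rewrite divr_gt0// lt_min V0_gt0.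
  have cV : c <= V 0 / 2 by rewrite ler_pM2r ?invr_gt0// ge_min lexx.
  have cphi : c <= phi 0 / 2 by rewrite ler_pM2r ?invr_gt0// ge_min lexx orbT.
  have [|x x1|x x1|L L0 LP] := @finite_existence_time R a (d / 2) c V phi ha _ c0.
  + lra.
  + by apply: le_trans cV _; apply: ltW; apply: dV; lra.
  + by apply: le_trans cphi _; apply: ltW; apply: dphi; lra.
  by exists L => // lam lamL T u umax; apply: LP lamL _ _ (max_classical umax).
- move=> lam lam0 [T| |] u umax // _ x x1; last first.
    by have := sol_time_gt0 (max_classical umax).
  have blowup := max_blowup umax (ltry T).
  apply: (global_blowup ha (max_classical umax) bV _ _ blowup x1).
    exact: profile_scale (ltW lam0) bphi.
  by rewrite phi1 mulr0.
- move=> phiC2 r r01 pos conv.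
  have [L L0 LP] := large_multiple_subsolution a1 r01 bV bphi V_C1 phiC2 pos conv.
  exists L => // lam lamL T u umax t x t0 tT x1.
  have lam0 : 0 < lam by exact: lt_le_trans lamL.
  have blam := profile_scale (ltW lam0) bphi.
  apply: (u_t_ge0 a1 (max_classical umax) bV blam _ (LP lam lamL)) => //.
  by rewrite phi1 mulr0.
Qed.
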